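(* Let $\mathbf{D}$ be the unit disk and $\mathbf{U}=\{z\in\mathbb{C}:\Im z>0\}$ the upper half-plane. Let $f=h+\overline{g}$ be a harmonic diffeomorphism of $\mathbf{D}$ onto $\mathbf{U}$, where $h,g$ are holomorphic on $\mathbf{D}$, with $f(0)=i$. Then for every $z\in\mathbf{D}$, $$|Df(z)|=|h'(z)|+|g'(z)|\ge \frac{1}{2}\,\mathrm{dist}(f(0),\partial\mathbf{U}),$$ and this inequality is sharp.
   Context: A harmonic map $f$ on a simply connected domain decomposes as $f=h+\overline{g}$ with $h,g$ holomorphic; $|Df(z)|$ denotes the operator norm of the differential, which equals $|h'(z)|+|g'(z)|$. Here $\partial\mathbf{U}=\mathbb{R}$, so $\mathrm{dist}(f(0),\partial\mathbf{U})=1$. *)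

(* Defs.v *)
From Stdlib Require Import Reals.
From Coquelicot Require Import Coquelicot.
Open Scope R_scope.

Definition unit_disk (z : C) : Prop := Cmod z < 1.
Definition upper_half_plane (w : C) : Prop := 0 < Im w.

Definition holomorphic_on_disk (h : C -> C) : Prop :=
  forall z, unit_disk z -> ex_derive h z.

Definition real_differentiable_at (f : C -> C) (z : C) : Prop :=
  @ex_filterdiff R_AbsRing C_R_NormedModule C_R_NormedModule f (locally z).

Definition diffeo_D_onto_U (f : C -> C) : Prop :=
  (forall z, unit_disk z -> upper_half_plane (f z)) /\
  (forall z, unit_disk z -> real_differentiable_at f z) /\
  exists F : C -> C,
    (forall w, upper_half_plane w -> unit_disk (F w) /\ f (F w) = w) /\
    (forall z, unit_disk z -> F (f z) = z) /\
    (forall w, upper_half_plane w -> real_differentiable_at F w).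

Definition admissible (f h g : C -> C) : Prop :=
  holomorphic_on_disk h /\ holomorphic_on_disk g /\
  (forall z, unit_disk z -> f z = Cplus (h z) (Cconj (g z))) /\
  diffeo_D_onto_U f /\
  f (RtoC 0) = Ci.

(* dist(w, ∂U) for w in U (∂U = R) is Im w. *)
Definition dist_to_boundary_U (w : C) : R := Rabs (Im w).

(* Main.v *)
Require Import Defs.
From Stdlib Require Import Reals.
From Coquelicot Require Import Coquelicot.
From Stdlib Require Import Lra Lia Psatz Classical ClassicalEpsilon Ranalysis5.
Open Scope R_scope.

(** Write [f = Re P + i Im phi] with [phi = h - g] and [P = h + g] holomorphic. Since [f] maps the
    disk onto the half-plane [U], [phi] has no critical point and is strictly monotone along the
    preimage of every horizontal line, so it is injective with values in [U].

    It is also onto [U]: if its image missed a horizontal half-line starting at [b0], then on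
    [{|phi - b0| < R}] the function [Re P] (up to sign) would be positive and tend to [+oo] at the
    unit circle, whereas a barrier built from [sqrt ((b0 - phi) / R)] shows that the missing
    half-line has positive harmonic measure. Hence [phi] is a conformal map of the disk onto [U],
    and Schwarz-Pick for its inverse together with Harnack's inequality for [Im phi] gives
    [|h'| + |g'| >= |phi'| >= 2 Im phi / (1 - |z|^2) >= 2 / (1 + |z|)^2 >= 1 / 2].

    The Cayley transform, with [g = 0], comes arbitrarily close to equality near [z = -1]. *)

(** * Compactness of rectangles *)

(** Schwarz-Pick for a map of the disk into [U] bounds [|phi'|] from above. A lower bound needs the
    inverse of [phi] on all of [U], so surjectivity is the crux. No inverse of [phi] is ever
    constructed: surjectivity enters only as properness, namely that preimages of closed boxes in
    [U] stay away from the unit circle, and the Schwarz-Pick quotient of the inverse is estimated as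
    a function of [z]. Nonvanishing of [phi'] and monotonicity come from differentiating
    [Im (phi (F w)) = Im w] and [Re (P (F w)) = Re w], where [F] is the inverse of [f]. As [F] is
    not assumed to be C^1, slopes cannot be followed continuously from one horizontal line to
    another; increments can, and they carry the sign. The maximum principle is stated for open sets
    that need not be connected and for functions that need not extend to the boundary, because it is
    applied to sets such as [{|phi - b0| < R}], of which nothing more is known. *)

Lemma rectangle_uniform (Q : R -> R -> R -> Prop) (a b a' b' : R) :
  (forall x y d d', Q x y d -> 0 < d' <= d -> Q x y d') ->
  (forall u v, a <= u <= b -> a' <= v <= b' ->
     exists d, 0 < d /\ forall x y, a <= x <= b -> a' <= y <= b' ->
       Rabs (x - u) < d -> Rabs (y - v) < d -> Q x y d) ->
  exists d, 0 < d /\ forall x y, a <= x <= b -> a' <= y <= b' -> Q x y d.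
Proof.
  intros Hmon Hloc.
  assert (Hex : forall u v, exists d : posreal, a <= u <= b -> a' <= v <= b' ->
     forall x y, a <= x <= b -> a' <= y <= b' ->
       Rabs (x - u) < d -> Rabs (y - v) < d -> Q x y d).
  { intros u v.
    destruct (classic (a <= u <= b /\ a' <= v <= b')) as [[Hu Hv]|Hn].
    - destruct (Hloc u v Hu Hv) as [d [Hd HQ]].
      exists (mkposreal d Hd). intros _ _. exact HQ.
    (* Outside the rectangle the gauge value is arbitrary. *)
    - exists (mkposreal 1 Rlt_0_1). tauto. }
  (* The local radii form a gauge. Compactness gives one [d] such that every point is
     [delta u v]-close to some tag [(u, v)] with [d <= delta u v]; monotonicity of [Q] then passes
     from [delta u v] to [d]. *)
  set (delta := fun u v => proj1_sig (constructive_indefinite_description _ (Hex u v))).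
  destruct (compactness_value_2d a b a' b' delta) as [d Hd].
  exists d. split; [apply cond_pos|].
  intros x y Hx Hy. specialize (Hd x y Hx Hy). apply NNPP in Hd.
  destruct Hd as [u [v [Hu [Hv [H1 [H2 H3]]]]]].
  apply (Hmon x y (delta u v)); [|split; [apply cond_pos|exact H3]].
  apply (proj2_sig (constructive_indefinite_description _ (Hex u v))); assumption.
Qed.

Lemma interval_uniform (Q : R -> R -> Prop) (a b : R) :
  (forall x d d', Q x d -> 0 < d' <= d -> Q x d') ->
  (forall u, a <= u <= b ->
     exists d, 0 < d /\ forall x, a <= x <= b -> Rabs (x - u) < d -> Q x d) ->
  exists d, 0 < d /\ forall x, a <= x <= b -> Q x d.
Proof.
  intros Hmon Hloc.
  destruct (rectangle_uniform (fun x _ d => Q x d) a b 0 0) as [d [Hd H]].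
  - intros x _ d d'. apply Hmon.
  - intros u v Hu _. destruct (Hloc u Hu) as [d [Hd H]].
    exists d. split; [exact Hd|]. intros x y Hx _ Hxu _. now apply H.
  - exists d. split; [exact Hd|]. intros x Hx. apply (H x 0 Hx). lra.
Qed.

(** * Complex differentiability *)

(** Remainder form with a non-strict bound: there is no quotient, so [w = z] needs no separate
    treatment. *)
Definition Cderiv (f : C -> C) (z d : C) : Prop :=
  forall eps, 0 < eps -> exists del, 0 < del /\
    forall w, Cmod (w - z) < del ->
      Cmod (f w - f z - d * (w - z)) <= eps * Cmod (w - z).

Lemma Cderiv_is_derive (f : C -> C) (z d : C) :
  Cderiv f z d <-> @is_derive C_AbsRing (AbsRing_NormedModule C_AbsRing) f z d.
Proof.
  split.
  - intros H. split; [apply is_linear_scal_l|].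
    intros x Hx eps.
    assert (Hxz : z = x) by (apply (@is_filter_lim_locally_unique C_AbsRing (AbsRing_NormedModule C_AbsRing)); exact Hx).
    subst x.
    destruct (H eps (cond_pos eps)) as [del [Hdel HH]].
    exists (mkposreal del Hdel). intros w Hw.
    specialize (HH w Hw).
    change (Cmod (f w - f z - (w - z) * d) <= eps * Cmod (w - z)).
    rewrite (Cmult_comm (w - z) d). exact HH.
  - intros [_ H] eps Heps.
    destruct (H z (fun P HP => HP) (mkposreal eps Heps)) as [[del Hdel] HH].
    exists del. split; [exact Hdel|]. intros w Hw. specialize (HH w Hw).
    change (Cmod (f w - f z - (w - z) * d) <= eps * Cmod (w - z)) in HH.
    rewrite (Cmult_comm d (w - z)). exact HH.
Qed.

(** The product and chain rules are taken over [AbsRing_NormedModule C_AbsRing], while [C_derive]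
    lives over [C_NormedModule]. The remainder estimates of the two are convertible, so only
    linearity is proved again. *)
Lemma Cderiv_is_derive_C (f : C -> C) (z d : C) :
  Cderiv f z d <-> @is_derive C_AbsRing C_NormedModule f z d.
Proof.
  rewrite Cderiv_is_derive.
  split; intros [_ H]; (split; [apply is_linear_scal_l|exact H]).
Qed.

Lemma Cderiv_ext_loc (f g : C -> C) (z d : C) (r : R) :
  0 < r -> (forall w, Cmod (w - z) < r -> f w = g w) -> Cderiv f z d -> Cderiv g z d.
Proof.
  intros Hr Hfg Hf eps Heps. destruct (Hf eps Heps) as [del [Hdel H]].
  exists (Rmin r del). split; [now apply Rmin_glb_lt|].
  intros w Hw.
  rewrite <- (Hfg w), <- (Hfg z).
  - apply H. eapply Rlt_le_trans; [exact Hw|apply Rmin_r].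
  - replace (z - z)%C with (RtoC 0) by ring. now rewrite Cmod_0.
  - eapply Rlt_le_trans; [exact Hw|apply Rmin_l].
Qed.

Lemma Cderiv_const (c z : C) : Cderiv (fun _ => c) z 0.
Proof.
  intros eps Heps. exists 1. split; [lra|]. intros w _.
  replace (c - c - 0 * (w - z))%C with (RtoC 0) by ring. rewrite Cmod_0.
  apply Rmult_le_pos; [lra|apply Cmod_ge_0].
Qed.

Lemma Cderiv_id (z : C) : Cderiv (fun w => w) z 1.
Proof.
  intros eps Heps. exists 1. split; [lra|]. intros w _.
  replace (w - z - 1 * (w - z))%C with (RtoC 0) by ring. rewrite Cmod_0.
  apply Rmult_le_pos; [lra|apply Cmod_ge_0].
Qed.

Lemma Cderiv_plus (f g : C -> C) (z df dg : C) :
  Cderiv f z df -> Cderiv g z dg -> Cderiv (fun w => f w + g w)%C z (df + dg).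
Proof.
  rewrite !Cderiv_is_derive. intros Hf Hg.
  exact (is_derive_plus (K := C_AbsRing) (V := AbsRing_NormedModule C_AbsRing) f g z df dg Hf Hg).
Qed.

Lemma Cderiv_mult (f g : C -> C) (z df dg : C) :
  Cderiv f z df -> Cderiv g z dg ->
  Cderiv (fun w => f w * g w)%C z (df * g z + f z * dg).
Proof.
  rewrite !Cderiv_is_derive. intros Hf Hg.
  exact (is_derive_mult (K := C_AbsRing) f g z df dg Hf Hg Cmult_comm).
Qed.

Lemma Cderiv_comp (f g : C -> C) (z df dg : C) :
  Cderiv f (g z) df -> Cderiv g z dg -> Cderiv (fun w => f (g w)) z (dg * df).
Proof.
  rewrite !Cderiv_is_derive. intros Hf Hg.
  exact (is_derive_comp (K := C_AbsRing) (V := AbsRing_NormedModule C_AbsRing) f g z df dg Hf Hg).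
Qed.

Lemma Cderiv_scal (c : C) (f : C -> C) (z df : C) :
  Cderiv f z df -> Cderiv (fun w => c * f w)%C z (c * df).
Proof.
  intros H. replace (c * df)%C with (0 * f z + c * df)%C by ring.
  apply (Cderiv_mult (fun _ => c) f); [apply Cderiv_const|exact H].
Qed.

Lemma Cderiv_opp (f : C -> C) (z df : C) :
  Cderiv f z df -> Cderiv (fun w => - f w)%C z (- df).
Proof.
  intros H eps Heps. destruct (H eps Heps) as [del [Hd HH]].
  exists del. split; [exact Hd|]. intros w Hw.
  replace (- f w - - f z - - df * (w - z))%C with (- (f w - f z - df * (w - z)))%C by ring.
  rewrite Cmod_opp. now apply HH.
Qed.

Lemma Cderiv_minus (f g : C -> C) (z df dg : C) :
  Cderiv f z df -> Cderiv g z dg -> Cderiv (fun w => f w - g w)%C z (df - dg).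
Proof.
  intros Hf Hg. apply (Cderiv_plus f (fun w => - g w)%C); [exact Hf|now apply Cderiv_opp].
Qed.

Lemma Cmod_le_abs (z : C) : Cmod z <= Rabs (Re z) + Rabs (Im z).
Proof.
  replace z with (RtoC (Re z) + Ci * RtoC (Im z))%C at 1.
  - eapply Rle_trans; [apply Cmod_triangle|].
    rewrite Cmod_mult, !Cmod_R, Cmod_Ci. lra.
  - destruct z as [x y]. unfold RtoC, Ci, Cplus, Cmult, Re, Im; simpl. f_equal; ring.
Qed.

Lemma im_le_Cmod (z : C) : Rabs (Im z) <= Cmod z.
Proof. eapply Rle_trans; [apply Rmax_r|apply Rmax_Cmod]. Qed.

Lemma Cmod_minus_sym (a b : C) : Cmod (a - b) = Cmod (b - a).
Proof. rewrite <- Cmod_opp. f_equal. ring. Qed.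

Lemma Cmod_triangle_rev (a b : C) : Cmod a - Cmod b <= Cmod (a - b).
Proof.
  generalize (Cmod_triangle (a - b) b). replace (a - b + b)%C with a by ring. lra.
Qed.

Lemma Cderiv_lipschitz (f : C -> C) (z d : C) :
  Cderiv f z d -> exists r, 0 < r /\
    forall w, Cmod (w - z) < r -> Cmod (f w - f z) <= (Cmod d + 1) * Cmod (w - z).
Proof.
  intros H. destruct (H 1 Rlt_0_1) as [r [Hr HH]].
  exists r. split; [exact Hr|]. intros w Hw. specialize (HH w Hw).
  replace (f w - f z)%C with ((f w - f z - d * (w - z)) + d * (w - z))%C by ring.
  eapply Rle_trans; [apply Cmod_triangle|]. rewrite Cmod_mult. lra.
Qed.

Definition Ccont (f : C -> C) (z : C) : Prop :=
  forall eps, 0 < eps -> exists del, 0 < del /\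
    forall w, Cmod (w - z) < del -> Cmod (f w - f z) < eps.

Lemma Cderiv_cont (f : C -> C) (z d : C) : Cderiv f z d -> Ccont f z.
Proof.
  intros H eps Heps. destruct (Cderiv_lipschitz f z d H) as [r [Hr HH]].
  assert (Hm := Cmod_ge_0 d).
  assert (He : 0 < eps / (Cmod d + 1)) by (apply Rdiv_lt_0_compat; lra).
  exists (Rmin r (eps / (Cmod d + 1))). split; [now apply Rmin_glb_lt|].
  intros w Hw. eapply Rle_lt_trans; [apply HH; eapply Rlt_le_trans; [exact Hw|apply Rmin_l]|].
  assert (Hw2 : Cmod (w - z) < eps / (Cmod d + 1))
    by (eapply Rlt_le_trans; [exact Hw|apply Rmin_r]).
  apply (Rmult_lt_compat_l (Cmod d + 1)) in Hw2; [|lra].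
  replace ((Cmod d + 1) * (eps / (Cmod d + 1))) with eps in Hw2 by (field; lra).
  exact Hw2.
Qed.

Lemma ex_Cderiv_cont (f : C -> C) (z : C) :
  (exists d, Cderiv f z d) -> Ccont f z.
Proof. intros [d Hd]. exact (Cderiv_cont f z d Hd). Qed.

(** The remainder is exactly [(w - z)^2 / (w * z^2)], and the first radius keeps [|w|] above
    [|z| / 2]. *)
Lemma Cderiv_inv (z : C) : z <> 0 -> Cderiv (fun w => / w)%C z (- / (z * z)).
Proof.
  intros Hz eps Heps.
  assert (Hm : 0 < Cmod z) by now apply Cmod_gt_0.
  set (m := Cmod z) in *.
  assert (Hm3 : 0 < m * m * m) by (apply Rmult_lt_0_compat; [apply Rmult_lt_0_compat|]; lra).
  exists (Rmin (m / 2) (eps * (m * m * m) / 2)). split.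
  { apply Rmin_glb_lt; [lra|]. apply Rdiv_lt_0_compat; [|lra]. now apply Rmult_lt_0_compat. }
  intros w Hw.
  assert (Hw1 : Cmod (w - z) < m / 2) by (eapply Rlt_le_trans; [exact Hw|apply Rmin_l]).
  assert (Hw2 : Cmod (w - z) < eps * (m * m * m) / 2) by (eapply Rlt_le_trans; [exact Hw|apply Rmin_r]).
  assert (Hwm : m / 2 < Cmod w).
  { generalize (Cmod_triangle_rev z w). rewrite Cmod_minus_sym. fold m. lra. }
  assert (Hw0 : w <> 0) by (apply Cmod_gt_0; lra).
  replace (/ w - / z - - / (z * z) * (w - z))%C with ((w - z) * (w - z) / (w * (z * z)))%C
    by (field; split; assumption).
  rewrite Cmod_div, !Cmod_mult by (repeat apply Cmult_neq_0; assumption).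
  fold m. set (k := Cmod (w - z)) in *. assert (Hk : 0 <= k) by apply Cmod_ge_0.
  apply (Rmult_le_reg_r (Cmod w * (m * m))); [repeat apply Rmult_lt_0_compat; lra|].
  unfold Rdiv. rewrite Rmult_assoc, Rinv_l, Rmult_1_r
    by (apply Rgt_not_eq; repeat apply Rmult_lt_0_compat; lra).
  replace (eps * k * (Cmod w * (m * m))) with (k * (eps * (Cmod w * (m * m)))) by ring.
  apply Rmult_le_compat_l; [exact Hk|].
  apply Rlt_le. eapply Rlt_le_trans; [exact Hw2|].
  replace (eps * (m * m * m) / 2) with (eps * (m / 2 * (m * m))) by field.
  apply Rmult_le_compat_l; [lra|]. apply Rmult_le_compat_r; [nra|lra].
Qed.

Lemma Cderiv_div (f g : C -> C) (z df dg : C) :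
  Cderiv f z df -> Cderiv g z dg -> g z <> 0 ->
  exists d, Cderiv (fun w => f w / g w)%C z d.
Proof.
  intros Hf Hg Hz. eexists.
  apply (Cderiv_mult f (fun w => / g w)%C); [exact Hf|].
  apply (Cderiv_comp (fun w => / w)%C g); [now apply Cderiv_inv|exact Hg].
Qed.

Lemma Cderiv_pow (f : C -> C) (z df : C) (n : nat) :
  Cderiv f z df -> exists d, Cderiv (fun w => f w ^ n)%C z d.
Proof.
  intros Hf. induction n as [|n [d IH]].
  - exists 0. exact (Cderiv_const 1 z).
  - eexists. apply (Cderiv_mult f (fun w => f w ^ n)%C); eassumption.
Qed.

(** * Goursat's theorem and the maximum principle *)

Definition cexp (z : C) : C := (exp (Re z) * cos (Im z), exp (Re z) * sin (Im z)).

Lemma cexp_plus (z w : C) : cexp (z + w) = (cexp z * cexp w)%C.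
Proof.
  destruct z as [a b], w as [c d]. unfold cexp, Cplus, Cmult, Re, Im; simpl.
  rewrite exp_plus, cos_plus, sin_plus. f_equal; ring.
Qed.

Lemma derivable_pt_lim_0_le (f : R -> R) (l : R) :
  derivable_pt_lim f 0 l -> forall eps, 0 < eps ->
  exists del, 0 < del /\ forall h, Rabs h < del -> Rabs (f h - f 0 - l * h) <= eps * Rabs h.
Proof.
  intros H eps Heps. destruct (H eps Heps) as [del Hd].
  exists del. split; [apply cond_pos|]. intros h Hh.
  destruct (Req_dec h 0) as [->|Hn].
  - replace (f 0 - f 0 - l * 0) with 0 by ring. rewrite Rabs_R0. lra.
  - specialize (Hd h Hn Hh). rewrite Rplus_0_l in Hd.
    replace (f h - f 0 - l * h) with (((f h - f 0) / h - l) * h) by (field; exact Hn).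
    rewrite Rabs_mult. apply Rmult_le_compat_r; [apply Rabs_pos|lra].
Qed.

Lemma Cderiv_cexp_0 : Cderiv cexp 0 1.
Proof.
  (* The real and imaginary parts of the remainder split into four terms, bounded by 1, 2, 4 and 1
     times [e * k]. *)
  intros eps Heps. set (e := eps / 8).
  destruct (derivable_pt_lim_0_le exp 1) with (eps := Rmin e 1) as [d1 [Hd1 H1]].
  { rewrite <- exp_0. apply derivable_pt_lim_exp. }
  { unfold e; apply Rmin_glb_lt; lra. }
  destruct (derivable_pt_lim_0_le cos 0) with (eps := e) as [d2 [Hd2 H2]].
  { generalize (derivable_pt_lim_cos 0). now rewrite sin_0, Ropp_0. }
  { unfold e; lra. }
  destruct (derivable_pt_lim_0_le sin 1) with (eps := Rmin e 1) as [d3 [Hd3 H3]].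
  { rewrite <- cos_0. apply derivable_pt_lim_sin. }
  { unfold e; apply Rmin_glb_lt; lra. }
  assert (He : 0 < e) by (unfold e; lra).
  set (d := Rmin (Rmin d1 (Rmin d2 d3)) (Rmin 1 e)).
  assert (Hd : 0 < d) by (unfold d; repeat apply Rmin_glb_lt; lra).
  assert (Ld : d <= d1 /\ d <= d2 /\ d <= d3 /\ d <= 1 /\ d <= e).
  { unfold d. generalize (Rmin_l (Rmin d1 (Rmin d2 d3)) (Rmin 1 e)) (Rmin_r (Rmin d1 (Rmin d2 d3)) (Rmin 1 e))
     (Rmin_l d1 (Rmin d2 d3)) (Rmin_r d1 (Rmin d2 d3)) (Rmin_l d2 d3) (Rmin_r d2 d3) (Rmin_l 1 e) (Rmin_r 1 e).
    lra. }
  exists d. split; [exact Hd|]. intros [a b] Hw.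
  assert (Ha : Rabs a <= Cmod ((a, b) - 0)).
  { replace a with (Re ((a, b) - 0)%C) at 1 by (unfold Re; simpl; ring). apply re_le_Cmod. }
  assert (Hb : Rabs b <= Cmod ((a, b) - 0)).
  { replace b with (Im ((a, b) - 0)%C) at 1 by (unfold Im; simpl; ring). apply im_le_Cmod. }
  set (k := Cmod ((a, b) - 0)) in *.
  assert (E1 := H1 a ltac:(lra)). assert (E2 := H2 b ltac:(lra)). assert (E3 := H3 b ltac:(lra)).
  rewrite exp_0 in E1. rewrite cos_0 in E2. rewrite sin_0 in E3.
  assert (Hk : 0 <= k) by apply Cmod_ge_0.
  assert (Pa := Rabs_pos a). assert (Pb := Rabs_pos b).
  assert (M1 := Rmin_l e 1). assert (M2 := Rmin_r e 1).
  assert (M0 : 0 < Rmin e 1) by (apply Rmin_glb_lt; lra).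
  assert (X1 : Rabs (exp a - 1 - 1 * a) <= e * k) by nra.
  assert (X1' : Rabs (exp a - 1 - 1 * a) <= k) by nra.
  assert (X2 : Rabs (cos b - 1 - 0 * b) <= e * k) by nra.
  assert (X3 : Rabs (sin b - 0 - 1 * b) <= e * k) by nra.
  assert (X3' : Rabs (sin b - 0 - 1 * b) <= k) by nra.
  eapply Rle_trans; [apply Cmod_le_abs|].
  assert (Cb : Rabs (cos b) <= 1) by (apply Rabs_le; apply COS_bound).
  replace (Re (cexp (a, b) - cexp 0 - 1 * ((a, b) - 0)))
    with ((exp a - 1 - 1 * a) * cos b + (1 + a) * (cos b - 1 - 0 * b))
    by (unfold cexp, Re, Im; simpl; rewrite exp_0, cos_0; ring).
  replace (Im (cexp (a, b) - cexp 0 - 1 * ((a, b) - 0)))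
    with (((exp a - 1 - 1 * a) + a) * ((sin b - 0 - 1 * b) + b) + (sin b - 0 - 1 * b))
    by (unfold cexp, Re, Im; simpl; rewrite sin_0; ring).
  assert (Y1 : Rabs ((exp a - 1 - 1 * a) * cos b) <= e * k).
  { rewrite Rabs_mult. generalize (Rabs_pos (exp a - 1 - 1 * a)) (Rabs_pos (cos b)). nra. }
  assert (Y2 : Rabs ((1 + a) * (cos b - 1 - 0 * b)) <= 2 * (e * k)).
  { rewrite Rabs_mult. assert (Rabs (1 + a) <= 2).
    { eapply Rle_trans; [apply Rabs_triang|]. rewrite Rabs_R1. lra. }
    generalize (Rabs_pos (1 + a)) (Rabs_pos (cos b - 1 - 0 * b)). nra. }
  assert (Y3 : Rabs (((exp a - 1 - 1 * a) + a) * ((sin b - 0 - 1 * b) + b)) <= 4 * (e * k)).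
  { rewrite Rabs_mult.
    assert (Rabs ((exp a - 1 - 1 * a) + a) <= 2 * k) by (eapply Rle_trans; [apply Rabs_triang|lra]).
    assert (Rabs ((sin b - 0 - 1 * b) + b) <= 2 * e).
    { eapply Rle_trans; [apply Rabs_triang|]. nra. }
    generalize (Rabs_pos ((exp a - 1 - 1 * a) + a)) (Rabs_pos ((sin b - 0 - 1 * b) + b)). nra. }
  assert (Z1 := Rabs_triang ((exp a - 1 - 1 * a) * cos b) ((1 + a) * (cos b - 1 - 0 * b))).
  assert (Z2 := Rabs_triang (((exp a - 1 - 1 * a) + a) * ((sin b - 0 - 1 * b) + b)) (sin b - 0 - 1 * b)).
  replace (eps * k) with (8 * (e * k)) by (unfold e; field). lra.
Qed.

Lemma Cderiv_cexp (z : C) : Cderiv cexp z (cexp z).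
Proof.
  apply (Cderiv_ext_loc (fun w => cexp z * cexp (w - z))%C _ _ _ 1 Rlt_0_1).
  { intros w _. rewrite <- cexp_plus. f_equal. ring. }
  match goal with |- Cderiv ?f z _ => enough (H : Cderiv f z (cexp z * 1)) by now rewrite Cmult_1_r in H end.
  apply (Cderiv_scal (cexp z) (fun w => cexp (w - z))).
  replace (RtoC 1) with ((1 - 0) * 1)%C by ring.
  apply (Cderiv_comp cexp (fun w => w - z)%C).
  - replace (z - z)%C with (RtoC 0) by ring. apply Cderiv_cexp_0.
  - apply Cderiv_minus; [apply Cderiv_id|apply Cderiv_const].
Qed.

(* [Im e ds + Re e dt] is the imaginary part of [e dz]: it is closed
   when [e] is holomorphic. *)
Definition boundary_integral (e : C -> C) (s1 s2 t1 t2 : R) : R :=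
  RInt (fun s => Im (e (s, t1)) - Im (e (s, t2))) s1 s2 +
  RInt (fun t => Re (e (s2, t)) - Re (e (s1, t))) t1 t2.

Lemma Cmod_horizontal (s s' t : R) : Cmod ((s', t) - (s, t)) = Rabs (s' - s).
Proof.
  replace ((s', t) - (s, t))%C with (RtoC (s' - s)) by (unfold RtoC, Cminus, Cplus, Copp; simpl; f_equal; ring).
  apply Cmod_R.
Qed.

Lemma Cmod_vertical (s t t' : R) : Cmod ((s, t') - (s, t)) = Rabs (t' - t).
Proof.
  replace ((s, t') - (s, t))%C with (Ci * RtoC (t' - t))%C
    by (unfold Ci, RtoC, Cminus, Cplus, Copp, Cmult; simpl; f_equal; ring).
  rewrite Cmod_mult, Cmod_Ci, Cmod_R. ring.
Qed.

Lemma Re_minus (z w : C) : Re (z - w) = Re z - Re w.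
Proof. reflexivity. Qed.

Lemma Im_minus (z w : C) : Im (z - w) = Im z - Im w.
Proof. reflexivity. Qed.

Lemma continuous_eps (f : R -> R) (x : R) :
  (forall eps, 0 < eps -> exists del, 0 < del /\ forall y, Rabs (y - x) < del -> Rabs (f y - f x) < eps) <->
  continuous f x.
Proof.
  split.
  - intros H. apply filterlim_locally. intros eps. destruct (H eps (cond_pos eps)) as [d [Hd HH]].
    exists (mkposreal d Hd). exact HH.
  - intros H eps Heps. destruct (proj1 (filterlim_locally _ _) H (mkposreal eps Heps)) as [d Hd].
    exists d. split; [apply cond_pos|exact Hd].
Qed.

Lemma Ccont_horizontal (e : C -> C) (s t : R) :
  Ccont e (s, t) -> continuous (fun s => Re (e (s, t))) s /\ continuous (fun s => Im (e (s, t))) s.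
Proof.
  intros H. split; apply continuous_eps; intros eps Heps; destruct (H eps Heps) as [d [Hd HH]];
    exists d; (split; [exact Hd|]); intros y Hy; specialize (HH (y, t));
    rewrite Cmod_horizontal in HH; specialize (HH Hy);
    rewrite <- ?Re_minus, <- ?Im_minus; eapply Rle_lt_trans; try exact HH;
    [apply re_le_Cmod|apply im_le_Cmod].
Qed.

Lemma Ccont_vertical (e : C -> C) (s t : R) :
  Ccont e (s, t) -> continuous (fun t => Re (e (s, t))) t /\ continuous (fun t => Im (e (s, t))) t.
Proof.
  intros H. split; apply continuous_eps; intros eps Heps; destruct (H eps Heps) as [d [Hd HH]];
    exists d; (split; [exact Hd|]); intros y Hy; specialize (HH (s, y));
    rewrite Cmod_vertical in HH; specialize (HH Hy);
    rewrite <- ?Re_minus, <- ?Im_minus; eapply Rle_lt_trans; try exact HH;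
    [apply re_le_Cmod|apply im_le_Cmod].
Qed.

Lemma ex_RInt_horizontal (e : C -> C) (s1 s2 t t' : R) :
  s1 <= s2 -> (forall s, s1 <= s <= s2 -> Ccont e (s, t) /\ Ccont e (s, t')) ->
  ex_RInt (fun s => Im (e (s, t)) - Im (e (s, t'))) s1 s2.
Proof.
  intros Hs H. apply (ex_RInt_continuous (V := R_CompleteNormedModule)).
  rewrite Rmin_left, Rmax_right by exact Hs. intros s Hss. destruct (H s Hss) as [H1 H2].
  apply (continuous_minus (V := R_NormedModule)).
  - exact (proj2 (Ccont_horizontal e s t H1)).
  - exact (proj2 (Ccont_horizontal e s t' H2)).
Qed.

Lemma ex_RInt_vertical (e : C -> C) (s s' t1 t2 : R) :
  t1 <= t2 -> (forall t, t1 <= t <= t2 -> Ccont e (s, t) /\ Ccont e (s', t)) ->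
  ex_RInt (fun t => Re (e (s, t)) - Re (e (s', t))) t1 t2.
Proof.
  intros Hs H. apply (ex_RInt_continuous (V := R_CompleteNormedModule)).
  rewrite Rmin_left, Rmax_right by exact Hs. intros t Hss. destruct (H t Hss) as [H1 H2].
  apply (continuous_minus (V := R_NormedModule)).
  - exact (proj1 (Ccont_vertical e s t H1)).
  - exact (proj1 (Ccont_vertical e s' t H2)).
Qed.

Lemma boundary_integral_split_s (e : C -> C) (s1 s2 t1 t2 m : R) :
  s1 <= m <= s2 -> t1 <= t2 ->
  (forall s t, s1 <= s <= s2 -> t1 <= t <= t2 -> Ccont e (s, t)) ->
  boundary_integral e s1 s2 t1 t2 =
  boundary_integral e s1 m t1 t2 + boundary_integral e m s2 t1 t2.
Proof.
  intros Hm Ht H. unfold boundary_integral.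
  rewrite <- (RInt_Chasles (V := R_CompleteNormedModule) _ s1 m s2).
  2, 3 : apply ex_RInt_horizontal; [lra|]; intros; split; apply H; lra.
  assert (E : RInt (fun t => Re (e (s2, t)) - Re (e (s1, t))) t1 t2 =
    RInt (fun t => Re (e (m, t)) - Re (e (s1, t))) t1 t2 +
    RInt (fun t => Re (e (s2, t)) - Re (e (m, t))) t1 t2).
  { rewrite <- (RInt_plus (V := R_CompleteNormedModule)).
    - apply RInt_ext. intros t _. unfold plus; simpl. ring.
    - apply ex_RInt_vertical; [lra|]; intros; split; apply H; lra.
    - apply ex_RInt_vertical; [lra|]; intros; split; apply H; lra. }
  rewrite E. unfold plus; simpl. ring.
Qed.

Lemma boundary_integral_split_t (e : C -> C) (s1 s2 t1 t2 m : R) :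
  s1 <= s2 -> t1 <= m <= t2 ->
  (forall s t, s1 <= s <= s2 -> t1 <= t <= t2 -> Ccont e (s, t)) ->
  boundary_integral e s1 s2 t1 t2 =
  boundary_integral e s1 s2 t1 m + boundary_integral e s1 s2 m t2.
Proof.
  intros Hs Hm H. unfold boundary_integral.
  rewrite <- (RInt_Chasles (V := R_CompleteNormedModule) _ t1 m t2).
  2, 3 : apply ex_RInt_vertical; [lra|]; intros; split; apply H; lra.
  assert (E : RInt (fun s => Im (e (s, t1)) - Im (e (s, t2))) s1 s2 =
    RInt (fun s => Im (e (s, t1)) - Im (e (s, m))) s1 s2 +
    RInt (fun s => Im (e (s, m)) - Im (e (s, t2))) s1 s2).
  { rewrite <- (RInt_plus (V := R_CompleteNormedModule)).
    - apply RInt_ext. intros s _. unfold plus; simpl. ring.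
    - apply ex_RInt_horizontal; [lra|]; intros; split; apply H; lra.
    - apply ex_RInt_horizontal; [lra|]; intros; split; apply H; lra. }
  rewrite E. unfold plus; simpl. ring.
Qed.

(** The affine part of [e] at [p] contributes [(s2 - s1) * (Re d * (t1 - t2))] on the horizontal
    sides and the opposite amount on the vertical ones. Only the remainder is left: at most
    [eps / 2 * L] per side, hence [eps * L] for a difference of opposite sides, integrated over
    lengths adding up to [L]. *)
Lemma boundary_integral_local (e : C -> C) (p d : C) (eps : R) :
  Cderiv e p d -> 0 < eps -> exists del, 0 < del /\
  forall s1 s2 t1 t2, s1 <= Re p <= s2 -> t1 <= Im p <= t2 ->
    (s2 - s1) + (t2 - t1) < del ->
    (forall s t, s1 <= s <= s2 -> t1 <= t <= t2 -> Ccont e (s, t)) ->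
    Rabs (boundary_integral e s1 s2 t1 t2) <= eps * ((s2 - s1) + (t2 - t1)) ^ 2.
Proof.
  intros Hd Heps. destruct (Hd (eps / 2)) as [del [Hdel H]]; [lra|].
  exists del. split; [exact Hdel|]. intros s1 s2 t1 t2 Hs Ht Hsm Hc.
  set (L := (s2 - s1) + (t2 - t1)) in *.
  assert (Herr : forall s t, s1 <= s <= s2 -> t1 <= t <= t2 ->
    Cmod (e (s, t) - e p - d * ((s, t) - p)) <= eps / 2 * L).
  { intros s t Hss Htt.
    assert (HL : Cmod ((s, t) - p) <= L).
    { eapply Rle_trans; [apply Cmod_le_abs|]. destruct p as [a b]. unfold Re, Im, L in *; simpl in *.
      apply Rplus_le_compat; apply Rabs_le; lra. }
    destruct (Rlt_dec (Cmod ((s, t) - p)) del) as [Hlt|]; [|lra].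
    eapply Rle_trans; [apply H; exact Hlt|]. apply Rmult_le_compat_l; lra. }
  unfold boundary_integral.
  assert (I1 : Rabs (RInt (fun s => Im (e (s, t1)) - Im (e (s, t2))) s1 s2 - (s2 - s1) * (Re d * (t1 - t2)))
     <= (s2 - s1) * (eps * L)).
  { assert (X1 : ex_RInt (fun s => Im (e (s, t1)) - Im (e (s, t2))) s1 s2)
      by (apply ex_RInt_horizontal; [lra|]; intros; split; apply Hc; lra).
    assert (X2 : ex_RInt (fun _ : R => Re d * (t1 - t2)) s1 s2) by apply ex_RInt_const.
    assert (E : RInt (fun s => Im (e (s, t1)) - Im (e (s, t2))) s1 s2 - (s2 - s1) * (Re d * (t1 - t2)) =
      RInt (fun s => (Im (e (s, t1)) - Im (e (s, t2))) - Re d * (t1 - t2)) s1 s2).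
    { etransitivity; [|symmetry; apply (RInt_minus (V := R_CompleteNormedModule)); assumption].
      rewrite RInt_const. reflexivity. }
    rewrite E. apply abs_RInt_le_const; [lra| |].
    - apply (ex_RInt_minus (V := R_NormedModule)); assumption.
    - intros s Hss.
      replace (Im (e (s, t1)) - Im (e (s, t2)) - Re d * (t1 - t2)) with
        (Im (e (s, t1) - e p - d * ((s, t1) - p)) - Im (e (s, t2) - e p - d * ((s, t2) - p)))
        by (destruct p, d; unfold Re, Im; simpl; ring).
      eapply Rle_trans; [apply Rabs_triang|]. rewrite Rabs_Ropp.
      generalize (Herr s t1 Hss ltac:(lra)) (Herr s t2 Hss ltac:(lra))
        (im_le_Cmod (e (s, t1) - e p - d * ((s, t1) - p)))
        (im_le_Cmod (e (s, t2) - e p - d * ((s, t2) - p))). lra. }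
  assert (I2 : Rabs (RInt (fun t => Re (e (s2, t)) - Re (e (s1, t))) t1 t2 - (t2 - t1) * (Re d * (s2 - s1)))
     <= (t2 - t1) * (eps * L)).
  { assert (X1 : ex_RInt (fun t => Re (e (s2, t)) - Re (e (s1, t))) t1 t2)
      by (apply ex_RInt_vertical; [lra|]; intros; split; apply Hc; lra).
    assert (X2 : ex_RInt (fun _ : R => Re d * (s2 - s1)) t1 t2) by apply ex_RInt_const.
    assert (E : RInt (fun t => Re (e (s2, t)) - Re (e (s1, t))) t1 t2 - (t2 - t1) * (Re d * (s2 - s1)) =
      RInt (fun t => (Re (e (s2, t)) - Re (e (s1, t))) - Re d * (s2 - s1)) t1 t2).
    { etransitivity; [|symmetry; apply (RInt_minus (V := R_CompleteNormedModule)); assumption].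
      rewrite RInt_const. reflexivity. }
    rewrite E. apply abs_RInt_le_const; [lra| |].
    - apply (ex_RInt_minus (V := R_NormedModule)); assumption.
    - intros t Htt.
      replace (Re (e (s2, t)) - Re (e (s1, t)) - Re d * (s2 - s1)) with
        (Re (e (s2, t) - e p - d * ((s2, t) - p)) - Re (e (s1, t) - e p - d * ((s1, t) - p)))
        by (destruct p, d; unfold Re, Im; simpl; ring).
      eapply Rle_trans; [apply Rabs_triang|]. rewrite Rabs_Ropp.
      generalize (Herr s2 t ltac:(lra) Htt) (Herr s1 t ltac:(lra) Htt)
        (re_le_Cmod (e (s2, t) - e p - d * ((s2, t) - p)))
        (re_le_Cmod (e (s1, t) - e p - d * ((s1, t) - p))). lra. }
  match goal with |- Rabs (?A + ?B) <= _ =>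
    replace (A + B) with ((A - (s2 - s1) * (Re d * (t1 - t2))) + (B - (t2 - t1) * (Re d * (s2 - s1)))) by ring
  end.
  eapply Rle_trans; [apply Rabs_triang|].
  replace (eps * L ^ 2) with ((s2 - s1) * (eps * L) + (t2 - t1) * (eps * L)) by (unfold L; ring).
  lra.
Qed.

(** A rectangle of generation [k] is recorded by its lower left corner alone. Lower ends increase
    and upper ends decrease, so the supremum of the lower ends lies in every interval. *)
Lemma nested_rectangles (P : nat -> R -> R -> Prop) (L H a b : R) :
  0 <= L -> 0 <= H -> P O a b ->
  (forall k x y, P k x y -> exists x' y', P (S k) x' y' /\
     x <= x' <= x + L / 2 ^ (S k) /\ y <= y' <= y + H / 2 ^ (S k)) ->
  exists p q, forall k, exists x y, P k x y /\
     x <= p <= x + L / 2 ^ k /\ y <= q <= y + H / 2 ^ k.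
Proof.
  intros HL HH H0 Hstep.
  assert (Hchoice : forall k x y, exists z : R * R, P k x y -> P (S k) (fst z) (snd z) /\
     x <= fst z <= x + L / 2 ^ (S k) /\ y <= snd z <= y + H / 2 ^ (S k)).
  { intros k x y. destruct (classic (P k x y)) as [Hp|Hn].
    - destruct (Hstep k x y Hp) as [x' [y' Hxy]]. exists (x', y'). intros _. exact Hxy.
    (* Default corner, used only where [P k x y] fails. *)
    - exists (0, 0). tauto. }
  pose (next := fun k z => proj1_sig
    (constructive_indefinite_description _ (Hchoice k (fst z) (snd z)))).
  pose (u := fix u k := match k with O => (a, b) | S k => next k (u k) end).
  assert (HP : forall k, P k (fst (u k)) (snd (u k))).
  { induction k as [|k IH]; [exact H0|].
    exact (proj1 (proj2_sig (constructive_indefinite_description _ (Hchoice k (fst (u k)) (snd (u k)))) IH)). }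
  assert (Hn : forall k, fst (u k) <= fst (u (S k)) <= fst (u k) + L / 2 ^ (S k) /\
                         snd (u k) <= snd (u (S k)) <= snd (u k) + H / 2 ^ (S k)).
  { intros k.
    exact (proj2 (proj2_sig (constructive_indefinite_description _ (Hchoice k (fst (u k)) (snd (u k)))) (HP k))). }
  assert (Hlim : forall (v : nat -> R) (M : R), 0 <= M ->
    (forall k, v k <= v (S k) <= v k + M / 2 ^ (S k)) ->
    exists p, forall k, v k <= p <= v k + M / 2 ^ k).
  { intros v M HM Hv.
    assert (Hhalf : forall k, M / 2 ^ k = M / 2 ^ (S k) + M / 2 ^ (S k)).
    { intros k. simpl. field. apply pow_nonzero. lra. }
    assert (Hpos : forall k, 0 <= M / 2 ^ k).
    { intros k. apply Rmult_le_pos; [exact HM|]. apply Rlt_le, Rinv_0_lt_compat, pow_lt. lra. }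
    assert (Hinc : forall k j, v k <= v (k + j)%nat /\ v (k + j)%nat + M / 2 ^ (k + j) <= v k + M / 2 ^ k).
    { intros k j. induction j as [|j IH].
      - rewrite Nat.add_0_r. lra.
      - rewrite Nat.add_succ_r. specialize (Hv (k + j)%nat). specialize (Hhalf (k + j)%nat). lra. }
    destruct (completeness (fun x => exists k, x = v k)) as [p [Hp1 Hp2]].
    - exists (v O + M / 2 ^ 0). intros x [k ->]. specialize (Hinc O k). specialize (Hpos k).
      simpl in *. lra.
    - exists (v O). now exists O.
    - exists p. intros k. split; [apply Hp1; now exists k|].
      apply Hp2. intros x [j ->].
      destruct (Nat.le_ge_cases k j) as [Hkj|Hjk].
      + replace j with (k + (j - k))%nat by lia.
        generalize (Hinc k (j - k)%nat) (Hpos (k + (j - k))%nat). lra.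
      + replace k with (j + (k - j))%nat by lia.
        generalize (Hinc j (k - j)%nat) (Hpos (j + (k - j))%nat). lra. }
  destruct (Hlim (fun k => fst (u k)) L HL) as [p Hp]; [intros k; apply Hn|].
  destruct (Hlim (fun k => snd (u k)) H HH) as [q Hq]; [intros k; apply Hn|].
  exists p, q. intros k. exists (fst (u k)), (snd (u k)). split; [apply HP|]. split; [apply Hp|apply Hq].
Qed.

Lemma pow_half_small (M del : R) : 0 <= M -> 0 < del -> exists k, M / 2 ^ k < del.
Proof.
  intros HM Hdel.
  destruct (pow_lt_1_zero (/ 2)) with (y := del / (M + 1)) as [N HN].
  - rewrite Rabs_pos_eq; lra.
  - apply Rdiv_lt_0_compat; lra.
  - exists N. specialize (HN N (Nat.le_refl _)).
    rewrite Rabs_pos_eq in HN by (apply pow_le; lra).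
    rewrite pow_inv in HN. unfold Rdiv.
    assert (Hp : 0 < / 2 ^ N) by (apply Rinv_0_lt_compat, pow_lt; lra).
    apply Rle_lt_trans with ((M + 1) * / 2 ^ N); [nra|].
    apply (Rmult_lt_compat_l (M + 1)) in HN; [|lra].
    replace ((M + 1) * (del / (M + 1))) with del in HN by (field; lra). exact HN.
Qed.

(** Bisection keeps an integral of size at least [K / 4^k] at generation [k], while
    differentiability at the common point bounds it by [eps * (T / 2^k)^2]. The powers of 4 cancel,
    leaving [K <= eps * T^2] for an [eps] of free choice. *)
Lemma goursat (e : C -> C) (s1 s2 t1 t2 : R) :
  s1 <= s2 -> t1 <= t2 ->
  (forall s t, s1 <= s <= s2 -> t1 <= t <= t2 -> exists d, Cderiv e (s, t) d) ->
  boundary_integral e s1 s2 t1 t2 = 0.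
Proof.
  intros Hs Ht He.
  assert (Hc : forall s t, s1 <= s <= s2 -> t1 <= t <= t2 -> Ccont e (s, t)).
  { intros s t H1 H2. destruct (He s t H1 H2) as [d Hd]. exact (Cderiv_cont _ _ _ Hd). }
  apply NNPP. intros Hn.
  set (L := s2 - s1). set (H := t2 - t1).
  set (K := Rabs (boundary_integral e s1 s2 t1 t2)).
  assert (HK : 0 < K) by now apply Rabs_pos_lt.
  pose (P := fun k x y => s1 <= x /\ x + L / 2 ^ k <= s2 /\ t1 <= y /\ y + H / 2 ^ k <= t2 /\
     K / 4 ^ k <= Rabs (boundary_integral e x (x + L / 2 ^ k) y (y + H / 2 ^ k))).
  assert (Hpos : forall M k, 0 <= M -> 0 <= M / 2 ^ k).
  { intros M k HM. apply Rmult_le_pos; [exact HM|]. apply Rlt_le, Rinv_0_lt_compat, pow_lt. lra. }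
  destruct (nested_rectangles P L H s1 t1) as [p [q Hpq]].
  - unfold L; lra.
  - unfold H; lra.
  - unfold P, L, H; simpl. rewrite !Rdiv_1_r.
    replace (s1 + (s2 - s1)) with s2 by ring. replace (t1 + (t2 - t1)) with t2 by ring.
    fold K. lra.
  - intros k x y [H1 [H2 [H3 [H4 H5]]]].
    set (l := L / 2 ^ (S k)). set (h := H / 2 ^ (S k)).
    assert (El : L / 2 ^ k = l + l) by (unfold l; simpl; field; apply pow_nonzero; lra).
    assert (Eh : H / 2 ^ k = h + h) by (unfold h; simpl; field; apply pow_nonzero; lra).
    assert (Hl : 0 <= l) by (apply Hpos; unfold L; lra).
    assert (Hh : 0 <= h) by (apply Hpos; unfold H; lra).
    rewrite El in *. rewrite Eh in *.
    set (m := K / 4 ^ (S k)). assert (Em : K / 4 ^ k = 4 * m) by (unfold m; simpl; field; apply pow_nonzero; lra).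
    rewrite Em in H5.
    assert (Hcc : forall s t, x <= s <= x + (l + l) -> y <= t <= y + (h + h) -> Ccont e (s, t))
      by (intros; apply Hc; lra).
    rewrite (boundary_integral_split_s e x (x + (l + l)) y (y + (h + h)) (x + l)) in H5
      by (solve [lra | assumption]).
    rewrite (boundary_integral_split_t e x (x + l) y (y + (h + h)) (y + h)) in H5
      by (try lra; intros; apply Hcc; lra).
    rewrite (boundary_integral_split_t e (x + l) (x + (l + l)) y (y + (h + h)) (y + h)) in H5
      by (try lra; intros; apply Hcc; lra).
    replace (x + (l + l)) with (x + l + l) in * by ring.
    replace (y + (h + h)) with (y + h + h) in * by ring.
    set (i1 := boundary_integral e x (x + l) y (y + h)) in *.
    set (i2 := boundary_integral e x (x + l) (y + h) (y + h + h)) in *.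
    set (i3 := boundary_integral e (x + l) (x + l + l) y (y + h)) in *.
    set (i4 := boundary_integral e (x + l) (x + l + l) (y + h) (y + h + h)) in *.
    assert (Hor : m <= Rabs i1 \/ m <= Rabs i2 \/ m <= Rabs i3 \/ m <= Rabs i4).
    { destruct (Rle_dec m (Rabs i1)); [tauto|]. destruct (Rle_dec m (Rabs i2)); [tauto|].
      destruct (Rle_dec m (Rabs i3)); [tauto|]. destruct (Rle_dec m (Rabs i4)); [tauto|]. exfalso.
      generalize (Rabs_triang (i1 + i2) (i3 + i4)) (Rabs_triang i1 i2) (Rabs_triang i3 i4). lra. }
    destruct Hor as [Hm|[Hm|[Hm|Hm]]].
    + exists x, y. unfold P. fold l h m. repeat split; try lra. exact Hm.
    + exists x, (y + h). unfold P. fold l h m. repeat split; try lra. exact Hm.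
    + exists (x + l), y. unfold P. fold l h m. repeat split; try lra. exact Hm.
    + exists (x + l), (y + h). unfold P. fold l h m. repeat split; try lra. exact Hm.
  - assert (Hp0 := Hpq O). destruct Hp0 as [x0 [y0 [[A1 [A2 [A3 [A4 _]]]] [A5 A6]]]].
    destruct (He p q) as [d Hd]; [lra|lra|].
    set (T := L + H). assert (HT : 0 <= T) by (unfold T, L, H; lra).
    (* Chosen so that [eps * T^2 < K]; the [+ 1] also covers a rectangle reduced to a point. *)
    set (eps := K / (T ^ 2 + 1)).
    assert (Heps : 0 < eps) by (apply Rdiv_lt_0_compat; [exact HK|nra]).
    destruct (boundary_integral_local e (p, q) d eps Hd Heps) as [del [Hdel Hloc]].
    destruct (pow_half_small T del HT Hdel) as [k Hk].
    destruct (Hpq k) as [x [y [[B1 [B2 [B3 [B4 B5]]]] [B6 B7]]]].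
    specialize (Hloc x (x + L / 2 ^ k) y (y + H / 2 ^ k)).
    assert (Hlt : K / 4 ^ k <= eps * (T / 2 ^ k) ^ 2).
    { eapply Rle_trans; [exact B5|].
      replace (T / 2 ^ k) with ((x + L / 2 ^ k - x) + (y + H / 2 ^ k - y)) by (unfold T; field; apply pow_nonzero; lra).
      apply Hloc; try assumption.
      - unfold T in Hk. unfold Rdiv in *. lra.
      - intros; apply Hc; lra. }
    assert (E4 : 4 ^ k = 2 ^ k * 2 ^ k) by (rewrite <- Rpow_mult_distr; f_equal; ring).
    assert (H2k : 0 < 2 ^ k) by (apply pow_lt; lra).
    assert (Heq : eps * (T / 2 ^ k) ^ 2 = eps * T ^ 2 * / 4 ^ k) by (rewrite E4; field; lra).
    rewrite Heq in Hlt. unfold Rdiv in Hlt.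
    apply Rmult_le_reg_r in Hlt; [|apply Rinv_0_lt_compat, pow_lt; lra].
    assert (EK : K = eps * (T ^ 2 + 1)) by (unfold eps; field; nra).
    nra.
Qed.

(** * Circular means and the maximum principle *)

Lemma Cmod_cexp (s t : R) : Cmod (cexp (s, t)) = exp s.
Proof.
  unfold Cmod, cexp, Re, Im; simpl. 
  replace (exp s * cos t * (exp s * cos t * 1) + exp s * sin t * (exp s * sin t * 1))
    with (exp s * exp s * (Rsqr (sin t) + Rsqr (cos t))) by (unfold Rsqr; ring).
  rewrite sin2_cos2, Rmult_1_r. apply sqrt_square, Rlt_le, exp_pos.
Qed.

(* In logarithmic polar coordinates [z = c + exp (s + i t)] the horizontal sides of
   [[s1, s2] x [0, 2 PI]] cancel by periodicity, so circular means do not depend on the radius. *)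
Lemma mean_value (E : C -> C) (c : C) (s2 : R) :
  (forall z, Cmod (z - c) <= exp s2 -> exists d, Cderiv E z d) ->
  RInt (fun t => Re (E (c + cexp (s2, t))%C)) 0 (2 * PI) = 2 * PI * Re (E c).
Proof.
  intros HE. assert (HPI := PI_RGT_0).
  set (e := fun w => E (c + cexp w)%C).
  assert (Hd : forall s t, s <= s2 -> exists d, Cderiv e (s, t) d).
  { intros s t Hs. destruct (HE (c + cexp (s, t))%C) as [d Hd].
    - replace (c + cexp (s, t) - c)%C with (cexp (s, t)) by ring. rewrite Cmod_cexp.
      destruct (Rle_lt_or_eq_dec s s2 Hs) as [Hlt| ->]; [|lra]. apply Rlt_le, exp_increasing, Hlt.
    - eexists. apply (Cderiv_comp E (fun w => c + cexp w)%C); [exact Hd|].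
      apply Cderiv_plus; [apply Cderiv_const|apply Cderiv_cexp]. }
  assert (Hc : forall s t, s <= s2 -> Ccont e (s, t)).
  { intros s t Hs. destruct (Hd s t Hs) as [d Hdd]. exact (Cderiv_cont _ _ _ Hdd). }
  assert (Hex : forall s, s <= s2 -> ex_RInt (fun t => Re (e (s, t))) 0 (2 * PI)).
  { intros s Hs. apply (ex_RInt_continuous (V := R_CompleteNormedModule)). intros t _.
    exact (proj1 (Ccont_vertical e s t (Hc s t Hs))). }
  assert (Hconst : forall s, s <= s2 ->
    RInt (fun t => Re (e (s2, t))) 0 (2 * PI) = RInt (fun t => Re (e (s, t))) 0 (2 * PI)).
  { intros s Hs. assert (G := goursat e s s2 0 (2 * PI) Hs ltac:(lra) ltac:(intros; now apply Hd)).
    unfold boundary_integral in G.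
    rewrite (RInt_ext _ (fun _ => 0)) in G.
    - rewrite RInt_const in G.
      assert (Em : RInt (fun t => Re (e (s2, t)) - Re (e (s, t))) 0 (2 * PI) =
        RInt (fun t => Re (e (s2, t))) 0 (2 * PI) - RInt (fun t => Re (e (s, t))) 0 (2 * PI)).
      { apply (RInt_minus (V := R_CompleteNormedModule)); apply Hex; lra. }
      rewrite Em in G. unfold scal in G; simpl in G. unfold mult in G; simpl in G. lra.
    - intros x _. unfold e, cexp, Re, Im; simpl. rewrite cos_0, sin_0, cos_2PI, sin_2PI. ring. }
  change (RInt (fun t => Re (e (s2, t))) 0 (2 * PI) = 2 * PI * Re (E c)).
  apply Rminus_diag_uniq, NNPP. intros Hn.
  set (D := RInt (fun t => Re (e (s2, t))) 0 (2 * PI) - 2 * PI * Re (E c)) in *.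
  assert (HD : 0 < Rabs D) by now apply Rabs_pos_lt.
  assert (Hc0 : Ccont E c).
  { destruct (HE c) as [d Hdd]; [|exact (Cderiv_cont _ _ _ Hdd)].
    replace (c - c)%C with (RtoC 0) by ring. rewrite Cmod_0. apply Rlt_le, exp_pos. }
  (* Integrated over a length [2 * PI], this tolerance bounds [Rabs D] by [Rabs D / 2], which is
     absurd. *)
  destruct (Hc0 (Rabs D / (4 * PI))) as [del [Hdel Hcc]]; [apply Rdiv_lt_0_compat; lra|].
  set (s := Rmin s2 (ln (del / 2))).
  assert (Hs : s <= s2) by apply Rmin_l.
  assert (Hsd : exp s < del).
  { assert (exp s <= exp (ln (del / 2))).
    { assert (Hr : s <= ln (del / 2)) by apply Rmin_r.
      destruct (Rle_lt_or_eq_dec _ _ Hr) as [Hlt| ->]; [|lra]. apply Rlt_le, exp_increasing, Hlt. }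
    rewrite exp_ln in H by lra. lra. }
  assert (HDe : D = RInt (fun t => Re (e (s, t)) - Re (E c)) 0 (2 * PI)).
  { unfold D. rewrite (Hconst s Hs).
    symmetry. etransitivity; [apply (RInt_minus (V := R_CompleteNormedModule));
      [now apply Hex|apply ex_RInt_const]|].
    rewrite RInt_const. unfold minus, plus, opp, scal; simpl. unfold mult; simpl. ring. }
  assert (Hb : Rabs D <= (2 * PI - 0) * (Rabs D / (4 * PI))).
  { rewrite HDe at 1. apply abs_RInt_le_const; [lra| |].
    - apply (ex_RInt_minus (V := R_NormedModule)); [now apply Hex|apply ex_RInt_const].
    - intros t _. rewrite <- Re_minus. eapply Rle_trans; [apply re_le_Cmod|].
      apply Rlt_le, Hcc. replace (c + cexp (s, t) - c)%C with (cexp (s, t)) by ring.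
      now rewrite Cmod_cexp. }
  replace ((2 * PI - 0) * (Rabs D / (4 * PI))) with (Rabs D / 2) in Hb by (field; lra). lra.
Qed.

(** [Re E + del * |z|^2] is strictly subharmonic: its mean over the circle of radius [r / 2] exceeds
    its value at [c] by [del * (r / 2)^2]. Strictness spares the propagation of a maximum through a
    connected set. *)
Lemma Re_no_strict_max (E : C -> C) (c : C) (r del : R) :
  0 < r -> 0 < del ->
  (forall z, Cmod (z - c) < r -> exists d, Cderiv E z d) ->
  (forall z, Cmod (z - c) < r -> Re (E z) + del * Cmod z ^ 2 <= Re (E c) + del * Cmod c ^ 2) ->
  False.
Proof.
  intros Hr Hdel HE Hmax. assert (HPI := PI_RGT_0).
  set (s := ln (r / 2)).
  assert (Hs : exp s = r / 2) by (apply exp_ln; lra).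
  (* adding a linear function turns [del * |z|^2] into [del * |z - c|^2] *)
  set (E1 := fun z => (E z + (2 * del)%R * Cconj c * (z - c))%C).
  assert (HE1 : forall z, Cmod (z - c) <= exp s -> exists d, Cderiv E1 z d).
  { intros z Hz. destruct (HE z) as [d Hd]; [lra|]. eexists. apply Cderiv_plus; [exact Hd|].
    apply (Cderiv_scal (RtoC (2 * del) * Cconj c) (fun w => w - c)%C).
    apply Cderiv_minus; [apply Cderiv_id|apply Cderiv_const]. }
  assert (M := mean_value E1 c s HE1).
  assert (Hle : RInt (fun t => Re (E1 (c + cexp (s, t))%C)) 0 (2 * PI) <=
    RInt (fun _ => Re (E1 c) - del * (r / 2) ^ 2) 0 (2 * PI)).
  { apply RInt_le; [lra| |apply ex_RInt_const|].
    - apply (ex_RInt_continuous (V := R_CompleteNormedModule)). intros t _.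
      refine (proj1 (Ccont_vertical (fun w => E1 (c + cexp w)%C) s t _)).
      destruct (HE1 (c + cexp (s, t))%C) as [d Hd].
      { replace (c + cexp (s, t) - c)%C with (cexp (s, t)) by ring. rewrite Cmod_cexp. lra. }
      eapply Cderiv_cont. apply (Cderiv_comp E1 (fun w => c + cexp w)%C); [exact Hd|].
      apply Cderiv_plus; [apply Cderiv_const|apply Cderiv_cexp].
    - intros t _.
      assert (Hz : Cmod (c + cexp (s, t) - c) = r / 2).
      { replace (c + cexp (s, t) - c)%C with (cexp (s, t)) by ring. now rewrite Cmod_cexp. }
      set (z := (c + cexp (s, t))%C) in *.
      specialize (Hmax z ltac:(lra)). rewrite <- Hz.
      rewrite !Cmod2_alt in *. unfold E1. clear -Hmax.
      destruct (E z) as [a b], (E c) as [a' b'], z as [x y], c as [x' y'].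
      unfold Re, Im, Cconj in *; simpl in *. nra. }
  rewrite M in Hle. rewrite RInt_const in Hle. unfold scal in Hle; simpl in Hle. unfold mult in Hle; simpl in Hle.
  assert (0 < del * (r / 2 * (r / 2 * 1))) by (repeat apply Rmult_lt_0_compat; lra).
  nra.
Qed.

(** If [Re E] exceeded [eta] somewhere, the perturbation [w = Re E + del * |z|^2] would still exceed
    its boundary bound, so its supremum would be attained inside [G], against [Re_no_strict_max]. *)
Lemma maximum_principle (G : C -> Prop) (E : C -> C) (eta : R) :
  (forall z, G z -> unit_disk z) ->
  (forall z, G z -> exists r, 0 < r /\ forall w, Cmod (w - z) < r -> G w) ->
  (forall z, G z -> exists d, Cderiv E z d) ->
  (forall z, Cmod z <= 1 -> ~ G z -> exists r, 0 < r /\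
     forall w, G w -> Cmod (w - z) < r -> Re (E w) <= eta) ->
  forall z, G z -> Re (E z) <= eta.
Proof.
  intros HGD HGo HE Hbd z0 Hz0. apply Rnot_lt_le. intros Hlt.
  (* Half of the excess: as [|z|^2 <= 1] on the disk, [w <= eta + del] wherever [Re E <= eta],
     whereas [w z0 >= eta + 2 * del]. *)
  set (del := (Re (E z0) - eta) / 2). assert (Hdel : 0 < del) by (unfold del; lra).
  set (w := fun z => Re (E z) + del * Cmod z ^ 2).
  assert (Hw0 : eta + del < w z0).
  { unfold w. generalize (pow2_ge_0 (Cmod z0)). unfold del in *. nra. }
  assert (Hwb : forall z, G z -> Re (E z) <= eta -> w z <= eta + del).
  { intros z Hz Hle. unfold w. apply HGD in Hz. unfold unit_disk in Hz.
    assert (Hp := Cmod_ge_0 z). assert (Cmod z ^ 2 <= 1) by nra. nra. }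
  assert (Hcont : forall z, G z -> forall eps, 0 < eps -> exists r, 0 < r /\
    forall z', Cmod (z' - z) < r -> w z' < w z + eps).
  { intros z Hz eps Heps. destruct (HE z Hz) as [d Hd].
    destruct (Cderiv_cont _ _ _ Hd (eps / 2)) as [r1 [Hr1 H1]]; [lra|].
    assert (Hm := Cmod_ge_0 z).
    set (k := del * (2 * Cmod z + 1)). assert (Hk : 0 < k) by (unfold k; nra).
    exists (Rmin r1 (Rmin 1 (eps / 2 / k))). split.
    { repeat apply Rmin_glb_lt; try lra. apply Rdiv_lt_0_compat; lra. }
    intros z' Hz'.
    assert (Ha : Cmod (z' - z) < r1) by (eapply Rlt_le_trans; [exact Hz'|apply Rmin_l]).
    assert (Hb : Cmod (z' - z) < 1)
      by (eapply Rlt_le_trans; [exact Hz'|eapply Rle_trans; [apply Rmin_r|apply Rmin_l]]).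
    assert (Hcc : Cmod (z' - z) < eps / 2 / k)
      by (eapply Rlt_le_trans; [exact Hz'|eapply Rle_trans; [apply Rmin_r|apply Rmin_r]]).
    specialize (H1 z' Ha).
    assert (Hre := re_le_Cmod (E z' - E z)). rewrite Re_minus in Hre.
    apply (Rmult_lt_compat_l k) in Hcc; [|exact Hk].
    replace (k * (eps / 2 / k)) with (eps / 2) in Hcc by (field; lra).
    assert (Ht := Cmod_triangle_rev z' z). assert (Hz'0 := Cmod_ge_0 z').
    assert (Hq := Cmod_ge_0 (z' - z)).
    assert (Hsq : del * Cmod z' ^ 2 <= del * Cmod z ^ 2 + k * Cmod (z' - z)).
    { unfold k. rewrite Rmult_assoc, <- Rmult_plus_distr_l. apply Rmult_le_compat_l; [lra|].
      nra. }
    unfold w. generalize (Rle_abs (Re (E z') - Re (E z))). lra. }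
  (* Compactness relative to [G]. A point of the closed disk outside [G] has a neighbourhood in
     which [w <= eta + del] on [G], and a point outside the closed disk has one that misses [G]; so
     [Q] is needed locally in [G] and uniformly where [w] is small. *)
  assert (Hloc : forall (Q : C -> R -> Prop),
    (forall z d d', Q z d -> 0 < d' <= d -> Q z d') ->
    (forall z, G z -> exists d, 0 < d /\ forall z', G z' -> Cmod (z' - z) < d -> Q z' d) ->
    (exists d, 0 < d /\ forall z, G z -> w z <= eta + del -> Q z d) ->
    exists d, 0 < d /\ forall z, G z -> Q z d).
  { intros Q Hmon HQ1 [d2 [Hd2 HQ2]].
    assert (Hsqrt : forall x y u v d, Rabs (x - u) < d / 2 -> Rabs (y - v) < d / 2 ->
      Cmod ((x, y) - (u, v)) < d).
    { intros x y u v d H1 H2. eapply Rle_lt_trans; [apply Cmod_le_abs|]. unfold Re, Im, Rminus in *; simpl. lra. }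
    destruct (rectangle_uniform (fun x y d => G (x, y) -> Q (x, y) d) (-1) 1 (-1) 1) as [d [Hd H]].
    - intros x y d d' H Hd Hg. exact (Hmon _ d d' (H Hg) Hd).
    - intros u v _ _. destruct (classic (G (u, v))) as [Hg|Hg].
      + destruct (HQ1 _ Hg) as [d [Hd H]]. exists (d / 2). split; [lra|].
        intros x y _ _ Hx Hy Hgxy. apply (Hmon _ d); [|lra]. apply H; [exact Hgxy|].
        now apply Hsqrt.
      + destruct (Rle_dec (Cmod (u, v)) 1) as [Hle|Hgt].
        * destruct (Hbd _ Hle Hg) as [r [Hr H]].
          exists (Rmin (r / 2) d2). split; [apply Rmin_glb_lt; lra|].
          intros x y _ _ Hx Hy Hgxy. apply (Hmon _ d2); [|split; [apply Rmin_glb_lt; lra|apply Rmin_r]].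
          apply HQ2; [exact Hgxy|]. apply Hwb; [exact Hgxy|]. apply H; [exact Hgxy|].
          apply Hsqrt; (eapply Rlt_le_trans; [eassumption|apply Rmin_l]).
        * set (r := Cmod (u, v) - 1). exists (r / 2). split; [unfold r; lra|].
          intros x y _ _ Hx Hy Hgxy. exfalso. apply HGD in Hgxy. unfold unit_disk in Hgxy.
          assert (Hc := Hsqrt x y u v r Hx Hy).
          generalize (Cmod_triangle_rev (u, v) (x, y)). rewrite Cmod_minus_sym. unfold r in *. lra.
    - exists d. split; [exact Hd|]. intros [x y] Hz. apply H; [| |exact Hz];
      apply HGD in Hz; unfold unit_disk in Hz; apply Rabs_le_between.
      + generalize (re_le_Cmod (x, y)). unfold Re; simpl. lra.
      + generalize (im_le_Cmod (x, y)). unfold Im; simpl. lra. }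
  (* An upper bound is written as [/ d], so that shrinking [d] weakens it. *)
  destruct (Hloc (fun z d => w z <= / d)) as [d [Hd HM]].
  { intros z d d' H Hd. eapply Rle_trans; [exact H|]. apply Rinv_le_contravar; lra. }
  { intros z Hz. destruct (Hcont z Hz 1 Rlt_0_1) as [r [Hr H]].
    assert (Hp : 0 < Rabs (w z) + 1) by (generalize (Rabs_pos (w z)); lra).
    exists (Rmin r (/ (Rabs (w z) + 1))). split.
    { apply Rmin_glb_lt; [exact Hr|]. now apply Rinv_0_lt_compat. }
    intros z' _ Hz'. apply Rle_trans with (/ / (Rabs (w z) + 1)).
    - rewrite Rinv_inv. apply Rlt_le, Rlt_le_trans with (w z + 1).
      + apply H. eapply Rlt_le_trans; [exact Hz'|apply Rmin_l].
      + generalize (Rle_abs (w z)). lra.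
    - apply Rinv_le_contravar; [|apply Rmin_r]. apply Rmin_glb_lt; [exact Hr|]. now apply Rinv_0_lt_compat. }
  { assert (Hp : 0 < Rabs (eta + del) + 1) by (generalize (Rabs_pos (eta + del)); lra).
    exists (/ (Rabs (eta + del) + 1)). split; [now apply Rinv_0_lt_compat|].
    intros z _ Hz. rewrite Rinv_inv. generalize (Rle_abs (eta + del)). lra. }
  destruct (completeness (fun m => exists z, G z /\ m = w z)) as [M [HM1 HM2]].
  { exists (/ d). intros m [z [Hz ->]]. now apply HM. }
  { exists (w z0), z0. auto. }
  assert (HMz0 : w z0 <= M) by (apply HM1; exists z0; auto).
  assert (Hatt : exists c, G c /\ M <= w c).
  { apply NNPP. intros Hno.
    (* An unattained supremum would leave a uniform margin below [M]. *)
    destruct (Hloc (fun z d => w z <= M - d)) as [d' [Hd' HM']].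
    - intros; lra.
    - intros z Hz. assert (Hlt' : w z < M).
      { apply Rnot_le_lt. intros Hle. apply Hno. exists z. auto. }
      destruct (Hcont z Hz ((M - w z) / 2)) as [r [Hr H]]; [lra|].
      exists (Rmin r ((M - w z) / 2)). split; [apply Rmin_glb_lt; lra|].
      intros z' _ Hz'. specialize (H z' ltac:(eapply Rlt_le_trans; [exact Hz'|apply Rmin_l])).
      generalize (Rmin_r r ((M - w z) / 2)). lra.
    - exists (M - (eta + del)). split; [lra|]. intros. lra.
    - assert (M <= M - d'); [|lra]. apply HM2. intros m [z [Hz ->]]. now apply HM'. }
  destruct Hatt as [c [Hc HMc]].
  destruct (HGo c Hc) as [r [Hr Hball]].
  apply (Re_no_strict_max E c r del Hr Hdel).
  - intros z Hz. apply HE, Hball, Hz.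
  - intros z Hz. apply Rle_trans with M; [|exact HMc]. apply HM1. exists z. split; [now apply Hball|reflexivity].
Qed.

(** * Surjectivity and properness of the shear *)

(* The principal square root, meaningful off the half-line [(-oo, 0]], that is, where
   [0 < Cmod w + Re w]. *)
Definition csqrt (w : C) : C :=
  let a := sqrt ((Cmod w + Re w) / 2) in (a, Im w / (2 * a)).

Lemma csqrt_Re_pos (w : C) : 0 < Cmod w + Re w -> 0 < Re (csqrt w).
Proof. intros H. unfold csqrt, Re; simpl. apply sqrt_lt_R0. unfold Re in H. lra. Qed.

Lemma csqrt_sqr (w : C) : 0 < Cmod w + Re w -> (csqrt w * csqrt w)%C = w.
Proof.
  intros H. assert (Ha := csqrt_Re_pos w H).
  assert (Hs : Re (csqrt w) * Re (csqrt w) = (Cmod w + Re w) / 2) by (apply sqrt_sqrt; lra).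
  assert (Hw := Cmod2_alt w).
  unfold csqrt in *. set (a := sqrt ((Cmod w + Re w) / 2)) in *.
  change (0 < a) in Ha. change (a * a = (Cmod w + Re w) / 2) in Hs.
  destruct w as [x y]. set (m := Cmod (x, y)) in *. unfold Re, Im in *; simpl in *.
  unfold Cmult; simpl. f_equal; [|field; lra].
  replace (y / (2 * a) * (y / (2 * a))) with (y * y / (4 * (a * a))) by (field; lra).
  rewrite Hs. replace (y * y) with ((m - x) * (m + x)) by nra. field. lra.
Qed.

Lemma Cderiv_csqrt (w : C) : 0 < Cmod w + Re w -> exists d, Cderiv csqrt w d.
Proof.
  intros Hw. exists (/ (2 * csqrt w))%C. intros eps Heps.
  assert (Ha := csqrt_Re_pos w Hw). set (s := csqrt w) in *. set (a := Re s) in *.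
  assert (Has : a <= Cmod s) by (generalize (re_le_Cmod s); rewrite Rabs_pos_eq; unfold a in *; lra).
  assert (Hs0 : s <> 0) by (apply Cmod_gt_0; lra).
  assert (Ha3 : 0 < a * a * a) by (repeat apply Rmult_lt_0_compat; lra).
  (* The first radius keeps [w'] off the slit, since [|w| + Re w] changes by at most
     [2 * |w' - w|]. *)
  exists (Rmin ((Cmod w + Re w) / 2) (eps * (2 * (a * a * a)))). split.
  { apply Rmin_glb_lt; [lra|]. apply Rmult_lt_0_compat; lra. }
  intros w' Hlt.
  assert (H1 : Cmod (w' - w) < (Cmod w + Re w) / 2) by (eapply Rlt_le_trans; [exact Hlt|apply Rmin_l]).
  assert (H2 : Cmod (w' - w) < eps * (2 * (a * a * a))) by (eapply Rlt_le_trans; [exact Hlt|apply Rmin_r]).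
  assert (Hw' : 0 < Cmod w' + Re w').
  { generalize (Cmod_triangle_rev w w') (re_le_Cmod (w' - w)). rewrite (Cmod_minus_sym w w').
    rewrite Re_minus. generalize (Rle_abs (- (Re w' - Re w))). rewrite Rabs_Ropp. lra. }
  assert (Ha' := csqrt_Re_pos w' Hw'). set (s' := csqrt w') in *.
  assert (Hsum : a <= Cmod (s' + s)).
  { eapply Rle_trans; [|apply re_le_Cmod]. eapply Rle_trans; [|apply Rle_abs].
    change (a <= Re s' + Re s). unfold a in *. lra. }
  assert (Hsum0 : (s' + s)%C <> 0) by (apply Cmod_gt_0; lra).
  assert (Ew : w = (s * s)%C) by (symmetry; now apply csqrt_sqr).
  assert (Ew' : w' = (s' * s')%C) by (symmetry; now apply csqrt_sqr).
  set (D := (w' - w)%C) in *.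
  assert (ED : (s' - s)%C = (D / (s' + s))%C) by (unfold D; rewrite Ew, Ew'; field; exact Hsum0).
  replace (s' - s - / (2 * s) * D)%C with (- (D * D / ((s' + s) * (s' + s) * (2 * s))))%C.
  2:{ replace (D * D)%C with ((s' - s) * (s' - s) * ((s' + s) * (s' + s)))%C
        by (rewrite ED; field; exact Hsum0).
      replace D with ((s' - s) * (s' + s))%C by (rewrite ED; field; exact Hsum0).
      field. now split. }
  rewrite Cmod_opp, Cmod_div, !Cmod_mult.
  2:{ repeat apply Cmult_neq_0; try assumption. intros E. apply (f_equal Re) in E. unfold Re in E; simpl in E. lra. }
  rewrite Cmod_R, (Rabs_pos_eq 2) by lra.
  set (k := Cmod D) in *. assert (Hk : 0 <= k) by apply Cmod_ge_0.
  set (u := Cmod (s' + s)) in *. set (v := Cmod s) in *.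
  assert (Huv : 2 * (a * a * a) <= u * u * (2 * v)).
  { assert (a * a <= u * u) by nra. assert (0 < a * a) by nra. nra. }
  apply (Rmult_le_reg_r (u * u * (2 * v))); [lra|].
  unfold Rdiv. rewrite Rmult_assoc, Rinv_l, Rmult_1_r by lra.
  replace (eps * k * (u * u * (2 * v))) with (k * (eps * (u * u * (2 * v)))) by ring.
  apply Rmult_le_compat_l; [exact Hk|].
  apply Rlt_le. eapply Rlt_le_trans; [exact H2|]. apply Rmult_le_compat_l; lra.
Qed.

(** For [csqrt w = x + i y] the bound reads [(1 - x)^2 - y^2 <= 1 - x^2 - y^2], that is [x^2 <= x],
    and [0 < x < 1]. The left side is thus a harmonic function without positive limit at [|w| = 1],
    although it is positive for [w] in the interval (0, 1). *)
Lemma csqrt_barrier (w : C) :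
  0 < Cmod w + Re w -> Cmod w < 1 ->
  Re ((1 - csqrt w) * (1 - csqrt w)) <= 1 - Cmod w.
Proof.
  intros Hw H1. assert (Ha := csqrt_Re_pos w Hw). assert (Hs := csqrt_sqr w Hw).
  set (s := csqrt w) in *.
  assert (Hm : Cmod w = Cmod s ^ 2) by (rewrite <- Hs, Cmod_mult; ring).
  rewrite Cmod2_alt in Hm.
  assert (Hre : Re s < 1) by (generalize (pow2_ge_0 (Im s)); nra).
  destruct s as [x y]. unfold Re, Im in *; simpl in *. nra.
Qed.

Lemma unit_disk_open (z : C) :
  unit_disk z -> exists r, 0 < r /\ forall w, Cmod (w - z) < r -> unit_disk w.
Proof.
  unfold unit_disk. intros Hz. exists (1 - Cmod z). split; [lra|].
  intros w Hw. generalize (Cmod_triangle_rev w z). lra.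
Qed.

(* If [psi] omitted the slit [(-1, 0]] inside the unit disk while [Re P] tends to [+oo] at the
   circle, the harmonic measure of the slit would vanish: [Re (1 - sqrt psi)^2] is bounded
   above by [1 - |psi|], and [eps * Re P] dominates it near the circle. *)
Lemma no_slit (psi P : C -> C) (z1 : C) :
  (forall z, unit_disk z -> exists d, Cderiv psi z d) ->
  (forall z, unit_disk z -> exists d, Cderiv P z d) ->
  (forall z, unit_disk z -> Cmod (psi z) < 1 -> 0 <= Re (P z) /\ 0 < Cmod (psi z) + Re (psi z)) ->
  (forall B, exists rho, rho < 1 /\ forall z, unit_disk z -> Cmod (psi z) < 1 ->
     Re (P z) <= B -> Cmod z <= rho) ->
  unit_disk z1 -> Cmod (psi z1) < 1 -> Im (psi z1) = 0 -> False.
Proof.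
  intros Hpsi HP Hpos Hproper Hz1 Hm1 Him.
  set (G := fun z => unit_disk z /\ Cmod (psi z) < 1).
  assert (Hmain : forall eta, 0 < eta ->
    forall z, G z -> Re ((1 - csqrt (psi z)) * (1 - csqrt (psi z)) - eta * P z) <= eta).
  { intros eta Heta. apply maximum_principle.
    - now intros z [Hz _].
    - intros z [Hz Hm]. destruct (unit_disk_open z Hz) as [r1 [Hr1 H1]].
      destruct (ex_Cderiv_cont _ _ (Hpsi z Hz) (1 - Cmod (psi z))) as [r2 [Hr2 H2]]; [lra|].
      exists (Rmin r1 r2). split; [now apply Rmin_glb_lt|]. intros w Hw. split.
      + apply H1. eapply Rlt_le_trans; [exact Hw|apply Rmin_l].
      + specialize (H2 w ltac:(eapply Rlt_le_trans; [exact Hw|apply Rmin_r])).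
        generalize (Cmod_triangle_rev (psi w) (psi z)). lra.
    - intros z [Hz Hm]. destruct (Hpos z Hz Hm) as [_ Hsl].
      destruct (Hpsi z Hz) as [d1 Hd1]. destruct (HP z Hz) as [d2 Hd2].
      destruct (Cderiv_csqrt _ Hsl) as [d3 Hd3].
      assert (H1s : Cderiv (fun w => 1 - csqrt (psi w))%C z (0 - d1 * d3)).
      { apply Cderiv_minus; [apply Cderiv_const|]. now apply (Cderiv_comp csqrt psi). }
      eexists. apply Cderiv_minus; [apply Cderiv_mult; exact H1s|].
      apply Cderiv_scal. exact Hd2.
    - intros z Hz Hn.
      assert (Hle : forall w, G w -> Re ((1 - csqrt (psi w)) * (1 - csqrt (psi w)) - eta * P w)
        <= 1 - Cmod (psi w) - eta * Re (P w)).
      { intros w [Hw Hwm]. rewrite Re_minus. destruct (Hpos w Hw Hwm) as [_ Hsl].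
        replace (Re (eta * P w)) with (eta * Re (P w)) by (destruct (P w); unfold Re; simpl; ring).
        generalize (csqrt_barrier _ Hsl Hwm). lra. }
      (* At a boundary point inside the disk [|psi| >= 1], so the barrier is small and [Re P >= 0]
         can only help. At the unit circle the barrier is at most 1 and [eta * Re P] exceeds 1. *)
      destruct (Rlt_dec (Cmod z) 1) as [Hlt|Hge].
      + assert (H1 : 1 <= Cmod (psi z)) by (apply Rnot_lt_le; intros H; apply Hn; now split).
        destruct (ex_Cderiv_cont _ _ (Hpsi z Hlt) eta Heta) as [r [Hr H]].
        exists r. split; [exact Hr|]. intros w Hw Hwz. eapply Rle_trans; [now apply Hle|].
        destruct Hw as [Hw Hwm]. destruct (Hpos w Hw Hwm) as [Hp _].
        generalize (Cmod_triangle_rev (psi z) (psi w)). rewrite (Cmod_minus_sym (psi z)).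
        specialize (H w Hwz). nra.
      + destruct (Hproper (/ eta)) as [rho [Hrho H]].
        exists (1 - rho). split; [lra|]. intros w Hw Hwz. eapply Rle_trans; [now apply Hle|].
        destruct Hw as [Hw Hwm].
        assert (Hbig : / eta < Re (P w)).
        { apply Rnot_le_lt. intros HB. specialize (H w Hw Hwm HB).
          generalize (Cmod_triangle_rev z w). rewrite Cmod_minus_sym. lra. }
        apply (Rmult_lt_compat_l eta) in Hbig; [|exact Heta]. rewrite Rinv_r in Hbig by lra.
        generalize (Cmod_ge_0 (psi w)). lra. }
  assert (Hg : G z1) by now split.
  destruct (Hpos z1 Hz1 Hm1) as [Hp1 Hsl1].
  set (q := Re ((1 - csqrt (psi z1)) * (1 - csqrt (psi z1)))).
  assert (Hq : 0 < q).
  { assert (Ha := csqrt_Re_pos _ Hsl1). assert (Hs := csqrt_sqr _ Hsl1).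
    assert (Hi : Im (csqrt (psi z1)) = 0) by (unfold csqrt, Im at 1; simpl; rewrite Him; unfold Rdiv; ring).
    assert (Hm : Cmod (psi z1) = Cmod (csqrt (psi z1)) ^ 2) by (rewrite <- Hs at 1; rewrite Cmod_mult; ring).
    rewrite Cmod2_alt, Hi in Hm. unfold q. destruct (csqrt (psi z1)) as [x y].
    unfold Re, Im in *; simpl in *. subst y. assert (x < 1) by nra. nra. }
  (* Solves [eta * (1 + Re (P z1)) = q / 2], whereas the bound at [z1] says
     [q <= eta * (1 + Re (P z1))]. *)
  set (eta := q / 2 / (1 + Re (P z1))).
  assert (Heta : 0 < eta) by (apply Rdiv_lt_0_compat; lra).
  specialize (Hmain eta Heta z1 Hg). rewrite Re_minus in Hmain. fold q in Hmain.
  replace (Re (eta * P z1)) with (eta * Re (P z1)) in Hmain by (destruct (P z1); unfold Re; simpl; ring).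
  assert (E : eta * (1 + Re (P z1)) = q / 2) by (unfold eta; field; lra). lra.
Qed.

(* [X] and [y] are the coordinates [Re P] and [Im phi] of the harmonic map [Re P + i Im phi],
   and [F] is its inverse; [J] is [{y > 0}] or, after the symmetry [(phi, P) -> (- phi, - P)],
   [{y < 0}]. *)
Record sheared (phi P : C -> C) (J : R -> Prop) (F : R -> R -> C) : Prop := {
  sh_phi : forall z, unit_disk z -> exists d, Cderiv phi z d;
  sh_P : forall z, unit_disk z -> exists d, Cderiv P z d;
  sh_open : forall y, J y -> exists r, 0 < r /\ forall y', Rabs (y' - y) < r -> J y';
  sh_disk : forall X y, J y -> unit_disk (F X y);
  sh_Re : forall X y, J y -> Re (P (F X y)) = X;
  sh_Im : forall X y, J y -> Im (phi (F X y)) = y;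
  sh_J : forall z, unit_disk z -> J (Im (phi z));
  sh_inv : forall z, unit_disk z -> F (Re (P z)) (Im (phi z)) = z;
  sh_cont : forall X y, J y -> forall eps, 0 < eps -> exists del, 0 < del /\
    forall X' y', Rabs (X' - X) < del -> Rabs (y' - y) < del -> Cmod (F X' y' - F X y) < eps;
  sh_incr : forall y, J y -> forall X X', X < X' -> Re (phi (F X y)) < Re (phi (F X' y))
}.

Arguments sh_phi {phi P J F}.
Arguments sh_P {phi P J F}.
Arguments sh_open {phi P J F}.
Arguments sh_disk {phi P J F}.
Arguments sh_Re {phi P J F}.
Arguments sh_Im {phi P J F}.
Arguments sh_J {phi P J F}.
Arguments sh_inv {phi P J F}.
Arguments sh_cont {phi P J F}.
Arguments sh_incr {phi P J F}.

(** * Consequences of monotone slices: unboundedness, injectivity, properness *)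

Section Sheared.

Variables (phi P : C -> C) (J : R -> Prop) (F : R -> R -> C).
Hypothesis Hsh : sheared phi P J F.

Lemma sheared_phi_cont (X y : R) :
  J y -> forall eps, 0 < eps -> exists del, 0 < del /\
    forall X' y', Rabs (X' - X) < del -> Rabs (y' - y) < del ->
      Rabs (Re (phi (F X' y')) - Re (phi (F X y))) < eps.
Proof.
  intros Hy eps Heps.
  destruct (ex_Cderiv_cont _ _ (sh_phi Hsh _ (sh_disk Hsh X y Hy)) eps Heps)
    as [d1 [Hd1 H1]].
  destruct (sh_cont Hsh X y Hy d1 Hd1) as [d2 [Hd2 H2]].
  exists d2. split; [exact Hd2|]. intros X' y' HX Hy'.
  rewrite <- Re_minus. eapply Rle_lt_trans; [apply re_le_Cmod|]. now apply H1, H2.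
Qed.

Lemma sheared_rectangle (a b y1 y2 : R) :
  (forall y, y1 <= y <= y2 -> J y) ->
  exists rho, rho < 1 /\ forall X y, a <= X <= b -> y1 <= y <= y2 -> Cmod (F X y) <= rho.
Proof.
  intros HJ.
  destruct (rectangle_uniform (fun X y d => Cmod (F X y) <= 1 - d) a b y1 y2) as [d [Hd H]].
  - intros; lra.
  - intros u v _ Hv. assert (Hm := sh_disk Hsh u v (HJ v Hv)). unfold unit_disk in Hm.
    destruct (sh_cont Hsh u v (HJ v Hv) ((1 - Cmod (F u v)) / 2)) as [d [Hd H]]; [lra|].
    exists (Rmin d ((1 - Cmod (F u v)) / 2)). split; [apply Rmin_glb_lt; lra|].
    intros x y _ _ Hx Hy.
    specialize (H x y ltac:(eapply Rlt_le_trans; [exact Hx|apply Rmin_l])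
      ltac:(eapply Rlt_le_trans; [exact Hy|apply Rmin_l])).
    generalize (Cmod_triangle_rev (F x y) (F u v)) (Rmin_r d ((1 - Cmod (F u v)) / 2)). lra.
  - exists (1 - d). split; [lra|]. exact H.
Qed.

Lemma sheared_incr_inv (y X X' : R) :
  J y -> Re (phi (F X y)) < Re (phi (F X' y)) -> X < X'.
Proof.
  intros Hy H. apply Rnot_le_lt. intros Hle.
  destruct (Rle_lt_or_eq_dec _ _ Hle) as [Hlt| ->]; [|lra].
  generalize (sh_incr Hsh y Hy _ _ Hlt). lra.
Qed.

(** If the slice at height [y0] had a finite supremum [b], it would not be attained, and [phi] would
    omit the half-line to the right of [b0 = (b, y0)]. Near [b0] the coordinate [Re P] is positive,
    and a bound on it confines [z] to the image of a compact rectangle, hence away from the circle: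
    exactly the situation excluded by [no_slit]. *)
Lemma sheared_unbounded (y0 A : R) : J y0 -> exists X, A < Re (phi (F X y0)).
Proof.
  intros Hy0. apply NNPP. intros Hno.
  assert (HA : forall X, Re (phi (F X y0)) <= A) by (intros X; apply Rnot_lt_le; intros H; apply Hno; now exists X).
  destruct (completeness (fun x => exists X, x = Re (phi (F X y0)))) as [b [Hb1 Hb2]].
  { exists A. intros x [X ->]. apply HA. }
  { exists (Re (phi (F 0 y0))). now exists 0. }
  assert (Hb : forall X, Re (phi (F X y0)) < b).
  { intros X. apply Rlt_le_trans with (Re (phi (F (X + 1) y0))).
    - apply (sh_incr Hsh); [exact Hy0|lra].
    - apply Hb1. now exists (X + 1). }
  set (r := b - Re (phi (F 0 y0))). assert (Hr : 0 < r) by (unfold r; specialize (Hb 0); lra).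
  destruct (sheared_phi_cont 0 y0 Hy0 (r / 2)) as [d1 [Hd1 H1]]; [lra|].
  destruct (sh_open Hsh y0 Hy0) as [d2 [Hd2 H2]].
  set (e := Rmin (r / 2) (Rmin (d1 / 2) (d2 / 2))).
  assert (He : 0 < e) by (unfold e; repeat apply Rmin_glb_lt; lra).
  assert (Le : e <= r / 2 /\ e < d1 /\ e < d2).
  { unfold e. generalize (Rmin_l (r / 2) (Rmin (d1 / 2) (d2 / 2))) (Rmin_r (r / 2) (Rmin (d1 / 2) (d2 / 2)))
      (Rmin_l (d1 / 2) (d2 / 2)) (Rmin_r (d1 / 2) (d2 / 2)). lra. }
  assert (HJ : forall y, Rabs (y - y0) <= e -> J y) by (intros y Hy; apply H2; lra).
  (* Sends [b0] to 0 and the omitted half-line to the negative real axis, with the disk of radius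
     [e] about [b0] becoming the unit disk. *)
  set (psi := fun z => (RtoC (/ e) * ((b, y0) - phi z))%C).
  assert (Epsi : forall z, Re (psi z) = (b - Re (phi z)) / e /\ Im (psi z) = (y0 - Im (phi z)) / e).
  { intros z. unfold psi. destruct (phi z) as [u v]. unfold Re, Im; simpl. split; field; lra. }
  assert (Hnear : forall z, unit_disk z -> Cmod (psi z) < 1 ->
    b - e < Re (phi z) /\ Rabs (Im (phi z) - y0) < e).
  { intros z Hz Hm. destruct (Epsi z) as [E1 E2].
    assert (Hx := re_le_Cmod (psi z)). assert (Hy := im_le_Cmod (psi z)). rewrite E1 in Hx. rewrite E2 in Hy.
    assert (Ha : forall t, Rabs (t / e) < 1 -> Rabs t < e).
    { intros t Ht. unfold Rdiv in Ht. rewrite Rabs_mult, Rabs_inv, (Rabs_pos_eq e) in Ht by lra.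
      apply (Rmult_lt_compat_r e) in Ht; [|exact He].
      rewrite Rmult_assoc, Rinv_l in Ht by lra. lra. }
    split.
    - generalize (Ha (b - Re (phi z)) ltac:(lra)) (Rle_abs (b - Re (phi z))). lra.
    - rewrite Rabs_minus_sym. apply Ha. lra. }
  (* On slices near [y0] the point with [X = 0] still has [Re phi < b - e], so by monotonicity any
     point with [Re phi > b - e] lies at some [X > 0]. *)
  assert (HX : forall z, unit_disk z -> Cmod (psi z) < 1 -> 0 < Re (P z)).
  { intros z Hz Hm. destruct (Hnear z Hz Hm) as [N1 N2].
    apply (sheared_incr_inv (Im (phi z))); [now apply (sh_J Hsh)|].
    rewrite (sh_inv Hsh z Hz).
    assert (H0 : Rabs (0 - 0) < d1) by (rewrite Rminus_0_r, Rabs_R0; exact Hd1).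
    specialize (H1 0 (Im (phi z)) H0 ltac:(lra)).
    generalize (Rle_abs (Re (phi (F 0 (Im (phi z)))) - Re (phi (F 0 y0)))). unfold r in *. lra. }
  destruct (classic (exists X, b - e < Re (phi (F X y0)))) as [[X1 HX1]|Hn].
  2:{ assert (b <= b - e); [|lra]. apply Hb2. intros x [X ->]. apply Rnot_lt_le. intros H. apply Hn. now exists X. }
  apply (no_slit psi P (F X1 y0)).
  - intros z Hz. destruct (sh_phi Hsh z Hz) as [d Hd]. eexists.
    apply Cderiv_scal. apply Cderiv_minus; [apply Cderiv_const|exact Hd].
  - apply (sh_P Hsh).
  - intros z Hz Hm. split; [now apply Rlt_le, HX|].
    destruct (Epsi z) as [E1 E2]. destruct (Req_dec (Im (phi z)) y0) as [Ey|Ey].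
    + assert (0 < Re (psi z)).
      { rewrite E1. apply Rdiv_lt_0_compat; [|exact He].
        assert (Hbz := Hb (Re (P z))). rewrite <- Ey, (sh_inv Hsh z Hz) in Hbz. lra. }
      generalize (Cmod_ge_0 (psi z)). lra.
    + assert (Hi : Im (psi z) <> 0).
      { rewrite E2. apply Rmult_integral_contrapositive_currified; [lra|]. apply Rinv_neq_0_compat. lra. }
      assert (Hsq := Cmod2_alt (psi z)). assert (Hm0 := Cmod_ge_0 (psi z)).
      assert (0 < Im (psi z) ^ 2) by (apply pow2_gt_0; exact Hi).
      apply Rnot_le_lt. intros Hle. nra.
  - intros B. destruct (sheared_rectangle 0 B (y0 - e) (y0 + e)) as [rho [Hrho H]].
    { intros y Hy. apply HJ, Rabs_le. lra. }
    exists rho. split; [exact Hrho|]. intros z Hz Hm HB.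
    rewrite <- (sh_inv Hsh z Hz). apply H.
    + split; [now apply Rlt_le, HX|exact HB].
    + destruct (Hnear z Hz Hm) as [_ N2]. apply Rlt_le, Rabs_le_between in N2. lra.
  - now apply (sh_disk Hsh).
  - destruct (Epsi (F X1 y0)) as [E1 E2]. rewrite (sh_Im Hsh) in E2 by exact Hy0.
    assert (E2' : Im (psi (F X1 y0)) = 0) by (rewrite E2; field; lra).
    eapply Rle_lt_trans; [apply Cmod_le_abs|]. rewrite E2', Rabs_R0, Rplus_0_r, E1.
    specialize (Hb X1). rewrite Rabs_pos_eq by (apply Rlt_le, Rdiv_lt_0_compat; lra).
    apply Rmult_lt_reg_r with e; [exact He|]. unfold Rdiv. rewrite Rmult_assoc, Rinv_l; lra.
  - destruct (Epsi (F X1 y0)) as [_ E2]. rewrite E2, (sh_Im Hsh) by exact Hy0. field. lra.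
Qed.

(** Turns unboundedness above into unboundedness below: both coordinates change sign, so slices stay
    increasing. *)
Lemma sheared_neg :
  sheared (fun z => - phi z)%C (fun z => - P z)%C (fun y => J (- y)) (fun X y => F (- X) (- y)).
Proof.
  constructor.
  - intros z Hz. destruct (sh_phi Hsh z Hz) as [d Hd]. eexists. apply Cderiv_opp, Hd.
  - intros z Hz. destruct (sh_P Hsh z Hz) as [d Hd]. eexists. apply Cderiv_opp, Hd.
  - intros y Hy. destruct (sh_open Hsh _ Hy) as [r [Hr H]]. exists r. split; [exact Hr|].
    intros y' Hy'. apply H. replace (- y' - - y) with (- (y' - y)) by ring. now rewrite Rabs_Ropp.
  - intros X y Hy. now apply (sh_disk Hsh).
  - intros X y Hy. change (- Re (P (F (- X) (- y))) = X). rewrite (sh_Re Hsh) by exact Hy. ring.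
  - intros X y Hy. change (- Im (phi (F (- X) (- y))) = y). rewrite (sh_Im Hsh) by exact Hy. ring.
  - intros z Hz. change (J (- - Im (phi z))). rewrite Ropp_involutive. now apply (sh_J Hsh).
  - intros z Hz. change (F (- - Re (P z)) (- - Im (phi z)) = z). rewrite !Ropp_involutive.
    now apply (sh_inv Hsh).
  - intros X y Hy eps Heps. destruct (sh_cont Hsh (- X) (- y) Hy eps Heps) as [d [Hd H]].
    exists d. split; [exact Hd|]. intros X' y' HX Hy'. apply H.
    + replace (- X' - - X) with (- (X' - X)) by ring. now rewrite Rabs_Ropp.
    + replace (- y' - - y) with (- (y' - y)) by ring. now rewrite Rabs_Ropp.
  - intros y Hy X X' HX. change (- Re (phi (F (- X) (- y))) < - Re (phi (F (- X') (- y)))).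
    apply Ropp_lt_contravar, (sh_incr Hsh); [exact Hy|lra].
Qed.

Lemma sheared_inj (z z' : C) : unit_disk z -> unit_disk z' -> phi z = phi z' -> z = z'.
Proof.
  intros Hz Hz' E. assert (Hy := sh_J Hsh z Hz).
  assert (Ez := sh_inv Hsh z Hz). assert (Ez' := sh_inv Hsh z' Hz').
  rewrite <- E in Ez'.
  destruct (Rtotal_order (Re (P z)) (Re (P z'))) as [Hlt|[Heq|Hlt]].
  - generalize (sh_incr Hsh _ Hy _ _ Hlt). rewrite Ez, Ez', E. lra.
  - rewrite <- Ez, <- Ez', Heq. reflexivity.
  - generalize (sh_incr Hsh _ Hy _ _ Hlt). rewrite Ez, Ez', E. lra.
Qed.

End Sheared.

(** Slices are increasing and unbounded in both directions. By compactness in [y], finitely many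
    heights decide, and the condition [|Re phi| <= A] confines [X] to one bounded interval for all
    heights at once. *)
Lemma sheared_proper (phi P : C -> C) (J : R -> Prop) (F : R -> R -> C) (A y1 y2 : R) :
  sheared phi P J F -> (forall y, y1 <= y <= y2 -> J y) ->
  exists rho, rho < 1 /\ forall z, unit_disk z ->
    Rabs (Re (phi z)) <= A -> y1 <= Im (phi z) <= y2 -> Cmod z <= rho.
Proof.
  intros Hsh HJ.
  assert (Hbound : forall phi P J F y1 y2, sheared phi P J F -> (forall y, y1 <= y <= y2 -> J y) ->
    exists d, 0 < d /\ forall y, y1 <= y <= y2 -> A < Re (phi (F (/ d) y))).
  { clear. intros phi P J F y1 y2 Hsh HJ.
    (* Writing [X] as [/ d] makes a smaller [d] a larger [X], the direction in which the slices
       grow. *)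
    destruct (interval_uniform (fun y d => 0 < d /\ (J y -> A < Re (phi (F (/ d) y)))) y1 y2) as [d [Hd H]].
    - intros y d d' [Hd H] Hd'. split; [lra|]. intros Hy.
      eapply Rlt_le_trans; [now apply H|].
      destruct (Rle_lt_or_eq_dec d' d) as [Hlt| ->]; [lra| |lra].
      apply Rlt_le, (sh_incr Hsh); [exact Hy|]. apply Rinv_lt_contravar; [nra|exact Hlt].
    - intros u Hu. destruct (sheared_unbounded _ _ _ _ Hsh u A (HJ u Hu)) as [X HX].
      destruct (sheared_phi_cont _ _ _ _ Hsh X u (HJ u Hu) (Re (phi (F X u)) - A)) as [d [Hd H]]; [lra|].
      assert (HX1 : 0 < Rabs X + 1) by (generalize (Rabs_pos X); lra).
      exists (Rmin d (/ (Rabs X + 1))). 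
      assert (Hpos : 0 < Rmin d (/ (Rabs X + 1))) by (apply Rmin_glb_lt; [exact Hd|now apply Rinv_0_lt_compat]).
      split; [exact Hpos|]. intros y Hy Hyu. split; [exact Hpos|]. intros HJy.
      assert (H0 : Rabs (X - X) < d) by (rewrite Rminus_diag, Rabs_R0; exact Hd).
      specialize (H X y H0 ltac:(eapply Rlt_le_trans; [exact Hyu|apply Rmin_l])).
      apply Rlt_trans with (Re (phi (F X y))).
      + apply Rabs_def2 in H. lra.
      + apply (sh_incr Hsh); [exact HJy|].
        apply Rlt_le_trans with (Rabs X + 1); [generalize (Rle_abs X); lra|].
        rewrite <- (Rinv_inv (Rabs X + 1)) at 1. apply Rinv_le_contravar; [exact Hpos|apply Rmin_r].
    - exists d. split; [exact Hd|]. intros y Hy. apply H; [exact Hy|now apply HJ]. }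
  destruct (Hbound _ _ _ _ y1 y2 Hsh HJ) as [d1 [Hd1 H1]].
  destruct (Hbound _ _ _ _ (- y2) (- y1) (sheared_neg _ _ _ _ Hsh)) as [d2 [Hd2 H2]].
  { intros y Hy. apply HJ. lra. }
  destruct (sheared_rectangle _ _ _ _ Hsh (- / d2) (/ d1) y1 y2 HJ) as [rho [Hrho H]].
  exists rho. split; [exact Hrho|]. intros z Hz HA Hy.
  rewrite <- (sh_inv Hsh z Hz). apply H; [|exact Hy].
  apply Rabs_le_between in HA.
  split; apply Rlt_le, (sheared_incr_inv _ _ _ _ Hsh (Im (phi z))); try (now apply HJ);
    rewrite (sh_inv Hsh z Hz).
  - specialize (H2 (- Im (phi z)) ltac:(lra)).
    change (A < - Re (phi (F (- / d2) (- - Im (phi z))))) in H2. rewrite Ropp_involutive in H2. lra.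
  - specialize (H1 (Im (phi z)) Hy). lra.
Qed.

(** * The shear of a harmonic diffeomorphism *)

(** [F] is only real differentiable while [phi] and [P] are complex differentiable; their
    compositions are differentiated along lines. *)
Definition curve_deriv (gamma : R -> C) (t0 : R) (k : C) : Prop :=
  forall eps, 0 < eps -> exists del, 0 < del /\ forall t, Rabs (t - t0) < del ->
    Cmod (gamma t - gamma t0 - RtoC (t - t0) * k) <= eps * Rabs (t - t0).

Lemma is_derive_eps (f : R -> R) (x l : R) :
  (forall eps, 0 < eps -> exists del, 0 < del /\ forall y, Rabs (y - x) < del ->
     Rabs (f y - f x - (y - x) * l) <= eps * Rabs (y - x)) ->
  is_derive f x l.
Proof.
  intros H. split; [apply is_linear_scal_l|]. intros x' Hx'.
  assert (Ex : x = x') by (apply is_filter_lim_locally_unique; exact Hx'). subst x'.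
  intros eps. destruct (H eps (cond_pos eps)) as [d [Hd HH]].
  exists (mkposreal d Hd). exact HH.
Qed.

Lemma curve_deriv_is_derive (gamma : R -> C) (t0 : R) (k : C) :
  curve_deriv gamma t0 k ->
  is_derive (fun t => Re (gamma t)) t0 (Re k) /\ is_derive (fun t => Im (gamma t)) t0 (Im k).
Proof.
  intros H. split; apply is_derive_eps; intros eps Heps; destruct (H eps Heps) as [d [Hd HH]];
    exists d; (split; [exact Hd|]); intros t Ht; eapply Rle_trans; try exact (HH t Ht).
  - eapply Rle_trans; [|apply re_le_Cmod]. apply Req_le. f_equal.
    destruct (gamma t), (gamma t0), k. unfold Re; simpl. ring.
  - eapply Rle_trans; [|apply im_le_Cmod]. apply Req_le. f_equal.
    destruct (gamma t), (gamma t0), k. unfold Im; simpl. ring.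
Qed.

Lemma curve_deriv_comp (phi : C -> C) (gamma : R -> C) (t0 : R) (d k : C) :
  Cderiv phi (gamma t0) d -> curve_deriv gamma t0 k ->
  curve_deriv (fun t => phi (gamma t)) t0 (d * k).
Proof.
  intros Hphi Hg eps Heps.
  assert (Hk := Cmod_ge_0 k). assert (Hd := Cmod_ge_0 d).
  set (e1 := eps / (2 * (Cmod k + 1))). assert (He1 : 0 < e1) by (apply Rdiv_lt_0_compat; lra).
  set (e2 := eps / (2 * (Cmod d + 1))). assert (He2 : 0 < e2) by (apply Rdiv_lt_0_compat; lra).
  destruct (Hphi e1 He1) as [r [Hr H1]].
  destruct (Hg e2 He2) as [d2 [Hd2 H2]]. destruct (Hg 1 Rlt_0_1) as [d3 [Hd3 H3]].
  exists (Rmin (r / (Cmod k + 1)) (Rmin d2 d3)). split.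
  { repeat apply Rmin_glb_lt; try assumption. apply Rdiv_lt_0_compat; lra. }
  intros t Ht. set (u := Rabs (t - t0)) in *. assert (Hu : 0 <= u) by apply Rabs_pos.
  assert (T1 : u < r / (Cmod k + 1)) by (eapply Rlt_le_trans; [exact Ht|apply Rmin_l]).
  assert (T2 : u < d2) by (eapply Rlt_le_trans; [exact Ht|eapply Rle_trans; [apply Rmin_r|apply Rmin_l]]).
  assert (T3 : u < d3) by (eapply Rlt_le_trans; [exact Ht|eapply Rle_trans; [apply Rmin_r|apply Rmin_r]]).
  specialize (H2 t T2). specialize (H3 t T3). fold u in H2, H3.
  assert (Hlip : Cmod (gamma t - gamma t0) <= (Cmod k + 1) * u).
  { replace (gamma t - gamma t0)%C with ((gamma t - gamma t0 - RtoC (t - t0) * k) + RtoC (t - t0) * k)%C by ring.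
    eapply Rle_trans; [apply Cmod_triangle|]. rewrite Cmod_mult, Cmod_R. fold u. lra. }
  assert (Hlt : Cmod (gamma t - gamma t0) < r).
  { eapply Rle_lt_trans; [exact Hlip|]. apply (Rmult_lt_compat_l (Cmod k + 1)) in T1; [|lra].
    replace ((Cmod k + 1) * (r / (Cmod k + 1))) with r in T1 by (field; lra). exact T1. }
  specialize (H1 _ Hlt).
  replace (phi (gamma t) - phi (gamma t0) - RtoC (t - t0) * (d * k))%C with
    ((phi (gamma t) - phi (gamma t0) - d * (gamma t - gamma t0)) +
     d * (gamma t - gamma t0 - RtoC (t - t0) * k))%C by ring.
  eapply Rle_trans; [apply Cmod_triangle|]. rewrite Cmod_mult.
  assert (B1 : e1 * Cmod (gamma t - gamma t0) <= eps / 2 * u).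
  { apply Rle_trans with (e1 * ((Cmod k + 1) * u)); [apply Rmult_le_compat_l; lra|].
    apply Req_le. unfold e1. field. lra. }
  assert (B2 : Cmod d * (e2 * u) <= eps / 2 * u).
  { apply Rle_trans with ((Cmod d + 1) * (e2 * u)).
    - apply Rmult_le_compat_r; [|lra]. apply Rmult_le_pos; lra.
    - apply Req_le. unfold e2. field. lra. }
  assert (Cmod d * Cmod (gamma t - gamma t0 - RtoC (t - t0) * k) <= Cmod d * (e2 * u))
    by (apply Rmult_le_compat_l; assumption).
  lra.
Qed.

Lemma norm_C_R (z : C) : norm (K := R_AbsRing) (V := C_R_NormedModule) z = Cmod z.
Proof.
  destruct z as [x y]. unfold norm; simpl. unfold prod_norm, Cmod; simpl. unfold norm; simpl. unfold abs; simpl.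
  f_equal. rewrite !Rmult_1_r, <- !Rabs_mult. rewrite !Rabs_pos_eq; nra.
Qed.

(** The shift by [t0] allows the parameter to be the moving coordinate of the point itself. *)
Lemma real_differentiable_curve (F : C -> C) (w v : C) (t0 : R) :
  real_differentiable_at F w -> Cmod v = 1 ->
  exists k, curve_deriv (fun t => F (w + RtoC (t - t0) * v)%C) t0 k.
Proof.
  intros [l [Hlin Hl]] Hv. exists (l v). intros eps Heps.
  destruct (Hl w (fun P H => H) (mkposreal eps Heps)) as [d Hd].
  exists d. split; [apply cond_pos|]. intros t Ht. set (u := t - t0) in *.
  replace (t0 - t0) with 0 by ring. replace (w + 0 * v)%C with w by ring.
  assert (Hball : ball (M := C_R_NormedModule) w d (w + RtoC u * v)%C).
  { assert (Hm : Cmod (RtoC u * v) < d) by (rewrite Cmod_mult, Hv, Cmod_R, Rmult_1_r; exact Ht).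
    split; unfold ball; simpl; unfold AbsRing_ball, abs, minus, plus, opp; simpl.
    - eapply Rle_lt_trans; [|exact Hm]. eapply Rle_trans; [|apply re_le_Cmod].
      apply Req_le. f_equal. destruct w, v. unfold Re; simpl. ring.
    - eapply Rle_lt_trans; [|exact Hm]. eapply Rle_trans; [|apply im_le_Cmod].
      apply Req_le. f_equal. destruct w, v. unfold Im; simpl. ring. }
  specialize (Hd _ Hball). rewrite !norm_C_R in Hd.
  assert (E1 : minus (G := C_R_NormedModule) (w + RtoC u * v)%C w = scal (V := C_R_NormedModule) u v).
  { destruct w as [w1 w2], v as [v1 v2]. unfold minus, plus, opp, scal; simpl.
    unfold prod_plus, prod_opp, prod_scal, Cplus; simpl. unfold plus, opp, scal; simpl. unfold mult; simpl.
    f_equal; ring. }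
  rewrite E1, (linear_scal l Hlin) in Hd.
  assert (E2 : Cmod (scal (V := C_R_NormedModule) u v) = Rabs u).
  { replace (scal (V := C_R_NormedModule) u v) with (RtoC u * v)%C.
    - now rewrite Cmod_mult, Hv, Cmod_R, Rmult_1_r.
    - destruct v. unfold scal; simpl. unfold prod_scal, Cmult; simpl. unfold scal; simpl. unfold mult; simpl. f_equal; ring. }
  rewrite E2 in Hd. eapply Rle_trans; [|exact Hd]. apply Req_le. f_equal.
  destruct (F (w + RtoC u * v)%C), (F w), (l v).
  unfold minus, plus, opp, scal; simpl.
  unfold prod_plus, prod_opp, prod_scal, Cplus; simpl. unfold plus, opp, scal; simpl. unfold mult; simpl.
  unfold Cminus, Cplus, Copp, Cmult; simpl. f_equal; ring.
Qed.

Lemma real_differentiable_cont (F : C -> C) (w : C) :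
  real_differentiable_at F w -> forall eps, 0 < eps -> exists del, 0 < del /\
    forall X y, Rabs (X - Re w) < del -> Rabs (y - Im w) < del -> Cmod (F (X, y) - F w) < eps.
Proof.
  intros H eps Heps. apply (filterdiff_continuous (U := C_R_NormedModule) (V := C_R_NormedModule) F w) in H.
  assert (He2 : 0 < eps / 2) by lra.
  destruct (proj1 (filterlim_locally _ _) H (mkposreal _ He2)) as [d Hd].
  exists d. split; [apply cond_pos|]. intros X y HX Hy.
  destruct (Hd (X, y)) as [B1 B2]; [split; assumption|].
  eapply Rle_lt_trans; [apply Cmod_le_abs|].
  change (Rabs (Re (F (X, y)) - Re (F w)) < eps / 2) in B1.
  change (Rabs (Im (F (X, y)) - Im (F w)) < eps / 2) in B2.
  rewrite Re_minus, Im_minus. lra.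
Qed.

Section Shear.

Variables (phi P F : C -> C).
Hypothesis Hphi : forall z, unit_disk z -> exists d, Cderiv phi z d.
Hypothesis HP : forall z, unit_disk z -> exists d, Cderiv P z d.
Hypothesis HFD : forall w, upper_half_plane w ->
  unit_disk (F w) /\ Re (P (F w)) = Re w /\ Im (phi (F w)) = Im w.
Hypothesis HF : forall w, upper_half_plane w -> real_differentiable_at F w.

(** Along the vertical line through [w], [Im (phi (F w))] is the height and has slope 1; a critical
    point of [phi] would give slope 0. *)
Lemma shear_phi_deriv_neq_0 (w d : C) : upper_half_plane w -> Cderiv phi (F w) d -> d <> 0.
Proof.
  intros Hw Hd E. subst d. unfold upper_half_plane in Hw.
  destruct (real_differentiable_curve F w Ci (Im w) (HF w Hw) Cmod_Ci) as [k Hk].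
  assert (Hd' : Cderiv phi (F (w + RtoC (Im w - Im w) * Ci)%C) 0).
  { replace (w + RtoC (Im w - Im w) * Ci)%C with w by (rewrite Rminus_diag; ring). exact Hd. }
  assert (Hc := curve_deriv_comp _ _ _ _ _ Hd' Hk).
  apply curve_deriv_is_derive in Hc as [_ Hc].
  replace (Im (0 * k)) with 0 in Hc by (destruct k; unfold Im; simpl; ring).
  assert (H1 : is_derive (fun t : R => t) (Im w) 0).
  { apply (is_derive_ext_loc _ _ _ _) with (2 := Hc).
    exists (mkposreal _ Hw). intros t Ht. change (Rabs (t - Im w) < Im w) in Ht.
    apply Rabs_def2 in Ht.
    assert (Hu : upper_half_plane (w + RtoC (t - Im w) * Ci)%C).
    { unfold upper_half_plane. destruct w. unfold Im in *; simpl in *. lra. }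
    destruct (HFD _ Hu) as [_ [_ Him]]. rewrite Him. destruct w. unfold Im; simpl. ring. }
  apply is_derive_unique in H1. rewrite Derive_id in H1. lra.
Qed.

(** Let [k] be the derivative of [F] along the slice. Constancy of [Im phi] there makes [d * k]
    real, and [Re P = X] gives [Re (p * k) = 1], so [k] is not 0. Neither is [d], hence the real
    number [d * k] is nonzero. *)
Lemma shear_slice_deriv (X y : R) : 0 < y ->
  exists l, l <> 0 /\ is_derive (fun X => Re (phi (F (X, y)))) X l.
Proof.
  intros Hy. assert (Hu : upper_half_plane (X, y)) by exact Hy.
  destruct (HFD _ Hu) as [HD _].
  destruct (Hphi _ HD) as [d Hd]. destruct (HP _ HD) as [p Hp].
  assert (H1 : Cmod 1 = 1) by apply Cmod_1.
  destruct (real_differentiable_curve F (X, y) 1 X (HF _ Hu) H1) as [k Hk].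
  assert (Hline : forall t, ((X, y) + RtoC (t - X) * 1)%C = (t, y)).
  { intros t. unfold Cplus, Cmult, RtoC; simpl. f_equal; ring. }
  assert (Hk' : curve_deriv (fun t => F (t, y)) X k).
  { intros eps Heps. destruct (Hk eps Heps) as [del [Hdel H]]. exists del. split; [exact Hdel|].
    intros t Ht. specialize (H t Ht). rewrite !Hline in H. exact H. }
  assert (C1 := curve_deriv_comp phi _ X d k Hd Hk'). apply curve_deriv_is_derive in C1 as [R1 I1].
  assert (C2 := curve_deriv_comp P _ X p k Hp Hk'). apply curve_deriv_is_derive in C2 as [R2 _].
  exists (Re (d * k)). split; [|exact R1]. intros E.
  assert (EI : Im (d * k) = 0).
  { apply is_derive_unique in I1. rewrite <- I1.
    rewrite (Derive_ext _ (fun _ => y)); [apply Derive_const|].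
    intros t. now apply (HFD (t, y)). }
  assert (EP : Re (p * k) = 1).
  { apply is_derive_unique in R2. rewrite <- R2.
    rewrite (Derive_ext _ (fun t => t)); [apply Derive_id|].
    intros t. now apply (HFD (t, y)). }
  assert (Edk : (d * k)%C = 0).
  { apply injective_projections; assumption. }
  assert (Hd0 := shear_phi_deriv_neq_0 _ d Hu Hd).
  assert (Hk0 : k = 0).
  { replace k with (/ d * (d * k))%C by (field; exact Hd0). rewrite Edk. ring. }
  rewrite Hk0 in EP. replace (p * 0)%C with (RtoC 0) in EP by ring. unfold Re in EP; simpl in EP. lra.
Qed.

Lemma shear_slice_neq (X X' y : R) : 0 < y -> X < X' ->
  Re (phi (F (X', y))) - Re (phi (F (X, y))) <> 0.
Proof.
  intros Hy HX E.
  assert (Hder : forall t, ex_derive (fun X => Re (phi (F (X, y)))) t).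
  { intros t. destruct (shear_slice_deriv t y Hy) as [l [_ Hl]]. now exists l. }
  set (Dv := Derive (fun X => Re (phi (F (X, y))))).
  destruct (MVT_gen (fun X => Re (phi (F (X, y)))) X X' Dv) as [c [_ Hc]].
  - intros t _. apply Derive_correct, Hder.
  - intros t _. apply continuity_pt_filterlim. exact (ex_derive_continuous (V := R_NormedModule) _ t (Hder t)).
  - destruct (shear_slice_deriv c y Hy) as [l [Hl0 Hl]]. apply is_derive_unique in Hl.
    change (Dv c = l) in Hl. rewrite Hl, E in Hc. symmetry in Hc. apply Rmult_integral in Hc. lra.
Qed.

Lemma shear_cont (w : C) : upper_half_plane w -> forall eps, 0 < eps -> exists del, 0 < del /\
  forall X y, Rabs (X - Re w) < del -> Rabs (y - Im w) < del ->
    Rabs (Re (phi (F (X, y))) - Re (phi (F w))) < eps.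
Proof.
  intros Hw eps Heps. destruct (HFD w Hw) as [HD _].
  destruct (ex_Cderiv_cont _ _ (Hphi _ HD) eps Heps) as [d1 [Hd1 H1]].
  destruct (real_differentiable_cont F w (HF w Hw) d1 Hd1) as [d2 [Hd2 H2]].
  exists d2. split; [exact Hd2|]. intros X y HX Hy.
  rewrite <- Re_minus. eapply Rle_lt_trans; [apply re_le_Cmod|]. now apply H1, H2.
Qed.

Lemma shear_segment_cont (a b a' b' s : R) :
  0 < a' + s * b' -> continuity_pt (fun s => Re (phi (F (a + s * b, a' + s * b')))) s.
Proof.
  intros Hpos. apply continuity_pt_filterlim, continuous_eps. intros eps Heps.
  destruct (shear_cont (a + s * b, a' + s * b') Hpos eps Heps) as [d [Hd H]].
  set (M := Rabs b + Rabs b' + 1).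
  assert (HM : 0 < M) by (unfold M; generalize (Rabs_pos b) (Rabs_pos b'); lra).
  exists (d / M). split; [now apply Rdiv_lt_0_compat|]. intros t Ht.
  assert (Hsmall : Rabs (t - s) * M < d).
  { apply (Rmult_lt_compat_r M) in Ht; [|exact HM].
    replace (d / M * M) with d in Ht by (field; lra). exact Ht. }
  assert (Hp := Rabs_pos (t - s)). assert (Hpb := Rabs_pos b). assert (Hpb' := Rabs_pos b').
  apply H; unfold Re, Im; simpl.
  - replace (a + t * b - (a + s * b)) with ((t - s) * b) by ring. rewrite Rabs_mult. unfold M in *. nra.
  - replace (a' + t * b' - (a' + s * b')) with ((t - s) * b') by ring. rewrite Rabs_mult. unfold M in *. nra.
Qed.

(** The triples with [X < X'] and [0 < y] form a convex set, on which the increment is continuous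
    and never 0. A change of sign along the segment between two of them would contradict the
    intermediate value theorem. *)
Lemma shear_same_direction (X0 X0' y0 X1 X1' y1 : R) :
  0 < y0 -> 0 < y1 -> X0 < X0' -> X1 < X1' ->
  Re (phi (F (X0', y0))) - Re (phi (F (X0, y0))) < 0 ->
  0 < Re (phi (F (X1', y1))) - Re (phi (F (X1, y1))) -> False.
Proof.
  intros Hy0 Hy1 H0 H1 Hn Hp.
  pose (g := fun s => Re (phi (F (X0' + s * (X1' - X0'), y0 + s * (y1 - y0))))
                    - Re (phi (F (X0 + s * (X1 - X0), y0 + s * (y1 - y0))))).
  assert (Hpos : forall s, 0 <= s <= 1 -> 0 < y0 + s * (y1 - y0)) by (intros; nra).
  destruct (IVT_interv g 0 1) as [s [Hs Es]].
  - intros s Hs. apply continuity_pt_minus; apply shear_segment_cont; now apply Hpos.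
  - lra.
  - unfold g. rewrite !Rmult_0_l, !Rplus_0_r. exact Hn.
  - unfold g. rewrite !Rmult_1_l, !Rplus_minus. exact Hp.
  - apply (shear_slice_neq (X0 + s * (X1 - X0)) (X0' + s * (X1' - X0')) (y0 + s * (y1 - y0)));
      [now apply Hpos| |exact Es].
    destruct (Req_dec s 0) as [->|Hs0]; [lra|].
    assert (0 < s * (X1' - X1)) by (apply Rmult_lt_0_compat; lra).
    assert (0 <= (1 - s) * (X0' - X0)) by (apply Rmult_le_pos; lra). lra.
Qed.

Hypothesis Hinv : forall z, unit_disk z -> 0 < Im (phi z) /\ F (Re (P z), Im (phi z)) = z.

(** If the slices decrease, replacing [P] by [- P] and [X] by [- X] makes them increase. The
    increment from 0 to 1 at height 1 decides which case holds. *)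
Lemma shear_sheared : exists P' F', sheared phi P' (fun y => 0 < y) F'.
Proof.
  assert (Hopen : forall y, 0 < y -> exists r, 0 < r /\ forall y', Rabs (y' - y) < r -> 0 < y').
  { intros y Hy. exists y. split; [exact Hy|]. intros y' H. apply Rabs_def2 in H. lra. }
  assert (Hsign : forall X X' y, 0 < y -> X < X' ->
    Re (phi (F (X', y))) - Re (phi (F (X, y))) < 0 \/ 0 < Re (phi (F (X', y))) - Re (phi (F (X, y)))).
  { intros X X' y Hy HX. generalize (shear_slice_neq X X' y Hy HX). lra. }
  destruct (Hsign 0 1 1) as [Hneg|Hpos]; [lra|lra| |].
  - exists (fun z => - P z)%C, (fun X y => F (- X, y)). constructor.
    + exact Hphi.
    + intros z Hz. destruct (HP z Hz) as [d Hd]. eexists. apply Cderiv_opp, Hd.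
    + exact Hopen.
    + intros X y Hy. now apply HFD.
    + intros X y Hy. change (- Re (P (F (- X, y))) = X). destruct (HFD (- X, y) Hy) as [_ [E _]].
      rewrite E. unfold Re; simpl. ring.
    + intros X y Hy. now apply (HFD (- X, y)).
    + intros z Hz. now apply Hinv.
    + intros z Hz. change (F (- - Re (P z), Im (phi z)) = z). rewrite Ropp_involutive. now apply Hinv.
    + intros X y Hy eps Heps.
      destruct (real_differentiable_cont F (- X, y) (HF (- X, y) Hy) eps Heps) as [d [Hd H]].
      exists d. split; [exact Hd|]. intros X' y' HX Hy'. apply H; unfold Re, Im; simpl; [|exact Hy'].
      replace (- X' - - X) with (- (X' - X)) by ring. now rewrite Rabs_Ropp.
    + intros y Hy X X' HX. destruct (Hsign (- X') (- X) y Hy) as [H|H]; [lra|lra|].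
      exfalso. apply (shear_same_direction 0 1 1 (- X') (- X) y); lra.
  - exists P, (fun X y => F (X, y)). constructor.
    + exact Hphi.
    + exact HP.
    + exact Hopen.
    + intros X y Hy. now apply HFD.
    + intros X y Hy. now apply (HFD (X, y)).
    + intros X y Hy. now apply (HFD (X, y)).
    + intros z Hz. now apply Hinv.
    + intros z Hz. now apply Hinv.
    + intros X y Hy. exact (real_differentiable_cont F (X, y) (HF (X, y) Hy)).
    + intros y Hy X X' HX. destruct (Hsign X X' y Hy HX) as [H|H]; [|lra].
      exfalso. apply (shear_same_direction X X' y 0 1 1); lra.
Qed.

End Shear.

(** * Schwarz-Pick estimates *)

Lemma maximum_modulus (G : C -> Prop) (E : C -> C) (M : R) :
  0 <= M ->
  (forall z, G z -> unit_disk z) ->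
  (forall z, G z -> exists r, 0 < r /\ forall w, Cmod (w - z) < r -> G w) ->
  (forall z, G z -> exists d, Cderiv E z d) ->
  (forall z, Cmod z <= 1 -> ~ G z -> exists r, 0 < r /\
     forall w, G w -> Cmod (w - z) < r -> Cmod (E w) <= M) ->
  forall z, G z -> Cmod (E z) <= M.
Proof.
  intros HM HGD HGo HE Hbd z Hz.
  destruct (Req_dec (Cmod (E z)) 0) as [E0|E0]; [lra|].
  assert (Hm : 0 < Cmod (E z)) by (generalize (Cmod_ge_0 (E z)); lra).
  set (m := Cmod (E z)) in *.
  (* The unimodular factor that rotates [E z] onto the positive real axis, so that a bound on real
     parts suffices. *)
  set (c := (Cconj (E z) * RtoC (/ m))%C).
  assert (Hc : Cmod c = 1).
  { unfold c. rewrite Cmod_mult, Cmod_conj, Cmod_R. fold m.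
    rewrite Rabs_pos_eq by (apply Rlt_le, Rinv_0_lt_compat, Hm). field. lra. }
  assert (Hre : Re (c * E z) = m).
  { assert (Hsq := Cmod2_alt (E z)). fold m in Hsq. unfold c.
    destruct (E z) as [x y]. unfold Re, Im, Cconj in *; simpl in *.
    replace ((x * / m - - y * 0) * x - (x * 0 + - y * / m) * y) with ((x * (x * 1) + y * (y * 1)) / m) by (field; lra).
    rewrite <- Hsq. field. lra. }
  rewrite <- Hre. apply (maximum_principle G (fun w => c * E w)%C); try assumption.
  - intros w Hw. destruct (HE w Hw) as [d Hd]. eexists. apply Cderiv_scal, Hd.
  - intros w Hw Hn. destruct (Hbd w Hw Hn) as [r [Hr H]]. exists r. split; [exact Hr|].
    intros u Hu Huw. eapply Rle_trans; [apply Rle_abs|]. eapply Rle_trans; [apply re_le_Cmod|].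
    rewrite Cmod_mult, Hc, Rmult_1_l. now apply H.
Qed.

(** Stands for taking n-th roots: if [x = y * (1 + h)] with [h > 0], Bernoulli's inequality makes
    [(1 + h)^n * K] exceed 2. *)
Lemma pow_bounded_le (x y K : R) :
  0 <= x -> 0 < y -> 0 < K -> (forall n, x ^ n * K <= 2 * y ^ n) -> x <= y.
Proof.
  intros Hx Hy HK H. apply Rnot_lt_le. intros Hlt.
  set (h := x / y - 1).
  assert (Hh : 0 < h). { unfold h. apply Rlt_0_minus. apply Rmult_lt_reg_r with y; [exact Hy|].
    unfold Rdiv. rewrite Rmult_assoc, Rinv_l; lra. }
  destruct (INR_unbounded (2 / (K * h))) as [n Hn].
  specialize (H n).
  replace x with (y * (1 + h)) in H by (unfold h; field; lra).
  rewrite Rpow_mult_distr in H.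
  assert (Hb := poly n h Hh). assert (Hyn : 0 < y ^ n) by now apply pow_lt.
  assert (HKh : 0 < K * h) by now apply Rmult_lt_0_compat.
  apply (Rmult_lt_compat_r (K * h)) in Hn; [|exact HKh].
  replace (2 / (K * h) * (K * h)) with 2 in Hn by (field; split; lra).
  assert (H2 : (1 + h) ^ n * K <= 2).
  { apply Rmult_le_reg_l with (y ^ n); [exact Hyn|]. lra. }
  nra.
Qed.

(* The puncture is removable because [q ^ n * (z - z0)] tends to 0 there; let [n] tend to infinity. *)
Lemma punctured_maximum_modulus (q : C -> C) (z0 : C) (B r0 : R) :
  unit_disk z0 -> 0 < r0 ->
  (forall z, unit_disk z -> z <> z0 -> exists d, Cderiv q z d) ->
  (forall z, unit_disk z -> z <> z0 -> Cmod (z - z0) < r0 -> Cmod (q z) <= B) ->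
  (forall eta, 0 < eta -> exists rho, rho < 1 /\
     forall z, unit_disk z -> z <> z0 -> rho < Cmod z -> Cmod (q z) <= 1 + eta) ->
  forall z, unit_disk z -> z <> z0 -> Cmod (q z) <= 1.
Proof.
  intros Hz0 Hr0 Hq HB Hbd z Hz Hzz.
  apply Rle_trans with (1 + 0); [|lra]. apply le_epsilon. intros eta Heta. rewrite Rplus_0_r.
  assert (Hd : 0 < Cmod (z - z0)).
  { apply Cmod_gt_0. intros E. apply Hzz. replace z with (z - z0 + z0)%C by ring. rewrite E. ring. }
  (* The fixed factor [K] is [|z - z0|]; the 2 on the other side bounds [|u - z0|] over the disk. *)
  apply pow_bounded_le with (Cmod (z - z0)); [apply Cmod_ge_0|lra|exact Hd|].
  intros n. rewrite <- Cmod_pow, <- Cmod_mult.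
  assert (HM : 0 < (1 + eta) ^ n) by (apply pow_lt; lra).
  apply (maximum_modulus (fun w => unit_disk w /\ w <> z0) (fun w => q w ^ n * (w - z0))%C); [lra| | | | |].
  - tauto.
  - intros w [Hw Hn]. destruct (unit_disk_open w Hw) as [r [Hr H]].
    assert (Hwz : 0 < Cmod (w - z0)).
    { apply Cmod_gt_0. intros E. apply Hn. replace w with (w - z0 + z0)%C by ring. rewrite E. ring. }
    exists (Rmin r (Cmod (w - z0))). split; [now apply Rmin_glb_lt|]. intros u Hu. split.
    + apply H. eapply Rlt_le_trans; [exact Hu|apply Rmin_l].
    + intros ->. rewrite Cmod_minus_sym in Hu. generalize (Rmin_r r (Cmod (w - z0))). lra.
  - intros w [Hw Hn]. destruct (Hq w Hw Hn) as [d Hdq].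
    destruct (Cderiv_pow _ _ _ n Hdq) as [d' Hd']. eexists. apply Cderiv_mult; [exact Hd'|].
    apply Cderiv_minus; [apply Cderiv_id|apply Cderiv_const].
  - intros w Hw Hn. destruct (classic (w = z0)) as [->|Hne].
    + set (B' := Rabs B). assert (HB' : 0 <= B' ^ n) by (apply pow_le, Rabs_pos).
      exists (Rmin r0 ((1 + eta) ^ n / (B' ^ n + 1))). split.
      { apply Rmin_glb_lt; [exact Hr0|]. apply Rdiv_lt_0_compat; lra. }
      intros u [Hu Hun] Huz.
      assert (U1 : Cmod (u - z0) < r0) by (eapply Rlt_le_trans; [exact Huz|apply Rmin_l]).
      assert (U2 : Cmod (u - z0) < (1 + eta) ^ n / (B' ^ n + 1)) by (eapply Rlt_le_trans; [exact Huz|apply Rmin_r]).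
      rewrite Cmod_mult, Cmod_pow.
      assert (Hpn : Cmod (q u) ^ n <= B' ^ n).
      { apply pow_incr. split; [apply Cmod_ge_0|]. eapply Rle_trans; [now apply HB|apply Rle_abs]. }
      apply (Rmult_lt_compat_l (B' ^ n + 1)) in U2; [|lra].
      replace ((B' ^ n + 1) * ((1 + eta) ^ n / (B' ^ n + 1))) with ((1 + eta) ^ n) in U2 by (field; lra).
      assert (Hu0 := Cmod_ge_0 (u - z0)). nra.
    + assert (Hw1 : Cmod w = 1).
      { apply Rle_antisym; [exact Hw|]. apply Rnot_lt_le. intros Hlt. apply Hn. now split. }
      destruct (Hbd eta Heta) as [rho [Hrho H]]. exists (1 - rho). split; [lra|].
      intros u [Hu Hun] Huw. rewrite Cmod_mult, Cmod_pow.
      assert (Hqu : Cmod (q u) <= 1 + eta).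
      { apply H; try assumption. generalize (Cmod_triangle_rev w u). rewrite Cmod_minus_sym. lra. }
      assert (Hpn : Cmod (q u) ^ n <= (1 + eta) ^ n) by (apply pow_incr; split; [apply Cmod_ge_0|exact Hqu]).
      assert (H2 : Cmod (u - z0) <= 2).
      { unfold unit_disk in *. eapply Rle_trans; [apply Cmod_triangle|]. rewrite Cmod_opp. lra. }
      assert (Hu0 := Cmod_ge_0 (u - z0)). assert (0 <= Cmod (q u) ^ n) by (apply pow_le, Cmod_ge_0). nra.
  - now split.
Qed.

(** Measures how far [(w - w0) / (w - conj w0)], which carries [U] to the unit disk, stays below
    modulus 1. [disk_automorphism_mod] is the analogue for the disk. *)
Lemma Cmod_conj_minus (w w0 : C) :
  Cmod (w - Cconj w0) ^ 2 = Cmod (w - w0) ^ 2 + 4 * Im w * Im w0.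
Proof.
  rewrite !Cmod2_alt. destruct w, w0. unfold Re, Im, Cconj; simpl. ring.
Qed.

Lemma Cmod_conj_minus_lower (w w0 : C) :
  0 < Im w -> 0 < Im w0 -> Im w0 <= Cmod (w - Cconj w0).
Proof.
  intros H H0. eapply Rle_trans; [|apply im_le_Cmod]. eapply Rle_trans; [|apply Rle_abs].
  destruct w, w0. unfold Im, Cconj in *; simpl in *. lra.
Qed.

Lemma disk_automorphism_mod (z z0 : C) :
  Cmod (1 - Cconj z0 * z) ^ 2 - Cmod (z - z0) ^ 2 = (1 - Cmod z ^ 2) * (1 - Cmod z0 ^ 2).
Proof.
  rewrite !Cmod2_alt. destruct z, z0. unfold Re, Im, Cconj; simpl. ring.
Qed.

Lemma disk_automorphism_den (z z0 : C) :
  unit_disk z -> unit_disk z0 -> 1 - Cmod z0 <= Cmod (1 - Cconj z0 * z).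
Proof.
  unfold unit_disk. intros Hz Hz0. generalize (Cmod_triangle_rev 1 (Cconj z0 * z)).
  rewrite Cmod_1, Cmod_mult, Cmod_conj. generalize (Cmod_ge_0 z) (Cmod_ge_0 z0). nra.
Qed.

Section SchwarzPick.

Variable phi : C -> C.
Hypothesis Hphi : forall z, unit_disk z -> exists d, Cderiv phi z d.
Hypothesis Hpos : forall z, unit_disk z -> 0 < Im (phi z).

(** Schwarz's lemma for [(phi - w0) / (phi - conj w0)] gives
    [|phi z - w0| <= |z| * |phi z - conj w0|]. Both sides contain the same real part, and since
    [|z| < 1] it may be dropped: [|v - v0| <= |z| * (v + v0)] for the imaginary parts. *)
Lemma Harnack (z : C) :
  unit_disk z -> Im (phi 0) * (1 - Cmod z) <= Im (phi z) * (1 + Cmod z).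
Proof.
  intros Hz. assert (H0 : unit_disk 0) by (unfold unit_disk; rewrite Cmod_0; lra).
  assert (Hp := Hpos z Hz). assert (Hp0 := Hpos 0 H0).
  destruct (classic (z = 0)) as [->|Hz0]; [rewrite Cmod_0; lra|].
  set (w0 := phi 0) in *.
  assert (Hden : forall u, unit_disk u -> (phi u - Cconj w0)%C <> 0).
  { intros u Hu. apply Cmod_gt_0. generalize (Cmod_conj_minus_lower (phi u) w0 (Hpos u Hu) Hp0). lra. }
  destruct (Hphi 0 H0) as [d0 Hd0].
  destruct (Cderiv_lipschitz _ _ _ Hd0) as [r [Hr Hlip]]. fold w0 in Hlip.
  assert (Hq : Cmod ((phi z - w0) / ((phi z - Cconj w0) * z)) <= 1).
  { apply (punctured_maximum_modulus (fun z => (phi z - w0) / ((phi z - Cconj w0) * z))%C 0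
      ((Cmod d0 + 1) / Im w0) r H0 Hr); try assumption.
    - intros u Hu Hu0. destruct (Hphi u Hu) as [d Hd].
      eapply Cderiv_div.
      + apply Cderiv_minus; [exact Hd|apply Cderiv_const].
      + apply Cderiv_mult; [|apply Cderiv_id]. apply Cderiv_minus; [exact Hd|apply Cderiv_const].
      + apply Cmult_neq_0; [now apply Hden|exact Hu0].
    - intros u Hu Hu0 Hur. specialize (Hlip u Hur).
      replace (u - 0)%C with u in Hlip by ring.
      rewrite Cmod_div, Cmod_mult by (apply Cmult_neq_0; [now apply Hden|exact Hu0]).
      assert (Hm := Cmod_conj_minus_lower (phi u) w0 (Hpos u Hu) Hp0).
      assert (Hmu : 0 < Cmod u) by now apply Cmod_gt_0.
      set (a := Cmod (phi u - Cconj w0)) in *. set (b := Cmod (phi u - w0)) in *.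
      apply Rle_div_l; [apply Rmult_lt_0_compat; lra|].
      eapply Rle_trans; [exact Hlip|].
      replace ((Cmod d0 + 1) / Im w0 * (a * Cmod u)) with ((Cmod d0 + 1) * Cmod u * (a / Im w0)) by (field; lra).
      rewrite <- (Rmult_1_r ((Cmod d0 + 1) * Cmod u)) at 1.
      apply Rmult_le_compat_l.
      + apply Rmult_le_pos; [generalize (Cmod_ge_0 d0)|]; lra.
      + apply Rle_div_r; lra.
    (* The numerator is at most [|phi u - conj w0|], so the quotient is at most [1 / |u|]. *)
    - intros eta Heta. exists (/ (1 + eta)). split.
      { apply Rmult_lt_reg_r with (1 + eta); [lra|]. rewrite Rinv_l; lra. }
      intros u Hu Hu0 Hrho.
      rewrite Cmod_div, Cmod_mult by (apply Cmult_neq_0; [now apply Hden|exact Hu0]).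
      assert (Hm := Cmod_conj_minus_lower (phi u) w0 (Hpos u Hu) Hp0).
      assert (Hs := Cmod_conj_minus (phi u) w0). assert (Hpu := Hpos u Hu).
      assert (Hmu : 0 < Cmod u) by now apply Cmod_gt_0.
      set (a := Cmod (phi u - Cconj w0)) in *. assert (Hb := Cmod_ge_0 (phi u - w0)).
      set (b := Cmod (phi u - w0)) in *.
      assert (Hab : b <= a). { apply Rnot_lt_le. intros Hlt. assert (0 < Im (phi u) * Im w0) by now apply Rmult_lt_0_compat. nra. }
      apply Rle_div_l; [apply Rmult_lt_0_compat; lra|].
      apply (Rmult_lt_compat_l (1 + eta)) in Hrho; [|lra]. rewrite Rinv_r in Hrho by lra.
      nra. }
  rewrite Cmod_div, Cmod_mult in Hq by (apply Cmult_neq_0; [now apply Hden|exact Hz0]).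
  assert (Hmu : 0 < Cmod z) by now apply Cmod_gt_0.
  assert (Hm := Cmod_conj_minus_lower (phi z) w0 Hp Hp0).
  apply Rle_div_l in Hq; [|apply Rmult_lt_0_compat; lra]. rewrite Rmult_1_l in Hq.
  assert (Hs := Cmod_conj_minus (phi z) w0). assert (Hsq := Cmod2_alt (phi z - w0)).
  rewrite Im_minus in Hsq.
  set (a := Cmod (phi z - Cconj w0)) in *. assert (Hb := Cmod_ge_0 (phi z - w0)).
  set (b := Cmod (phi z - w0)) in *. set (x2 := Re (phi z - w0)) in *.
  set (v := Im (phi z)) in *. set (v0 := Im w0) in *. set (t := Cmod z) in *.
  unfold unit_disk in Hz. fold t in Hz.
  assert (Hsq2 : b ^ 2 <= a ^ 2 * t ^ 2) by nra.
  assert (Hkey : (v - v0) ^ 2 <= ((v + v0) * t) ^ 2).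
  { assert (0 <= x2 ^ 2) by apply pow2_ge_0. assert (t ^ 2 <= 1) by nra. nra. }
  apply Rnot_lt_le. intros Hlt.
  assert (H1 : 0 <= (v + v0) * t) by nra. assert (H2 : (v + v0) * t < v0 - v) by lra. nra.
Qed.

Hypothesis Hinj : forall z z', unit_disk z -> unit_disk z' -> phi z = phi z' -> z = z'.
Hypothesis Hproper : forall A y1 y2, 0 < y1 ->
  exists rho, rho < 1 /\ forall z, unit_disk z ->
    Rabs (Re (phi z)) <= A -> y1 <= Im (phi z) <= y2 -> Cmod z <= rho.

(** Near the circle [phi] has left a large box, so it is close to the real axis, very high or far to
    the side. In each case [4 * v * v0], the difference of the two squared distances, is small
    against [|phi - w0|^2]. *)
Lemma pseudo_hyperbolic_boundary (w0 : C) (eta : R) :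
  0 < Im w0 -> 0 < eta -> exists rho, rho < 1 /\ forall z, unit_disk z -> rho < Cmod z ->
    Cmod (phi z - Cconj w0) <= (1 + eta) * Cmod (phi z - w0).
Proof.
  intros Hv0 Heta. set (v0 := Im w0) in *.
  (* The box is tuned to [4 * v * v0 <= 2 * eta * b^2]. Here [b] is at least [v0 / 2] below [y1], at
     least [v / 2] above [y2], and at least [A] beyond the lateral sides. The bound suffices because
     [1 + 2 * eta <= (1 + eta)^2]. *)
  set (y1 := Rmin (v0 / 2) (eta * v0 / 8)). set (y2 := Rmax (2 * v0) (8 * v0 / eta)).
  assert (Hy1 : 0 < y1) by (apply Rmin_glb_lt; [lra|]; apply Rdiv_lt_0_compat; [now apply Rmult_lt_0_compat|lra]).
  assert (L1 : y1 <= v0 / 2) by apply Rmin_l. assert (L2 : y1 <= eta * v0 / 8) by apply Rmin_r.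
  assert (L3 : 2 * v0 <= y2) by apply Rmax_l. assert (L4 : 8 * v0 / eta <= y2) by apply Rmax_r.
  assert (L5 : 8 * v0 <= eta * y2).
  { apply (Rmult_le_compat_l eta) in L4; [|lra]. replace (eta * (8 * v0 / eta)) with (8 * v0) in L4 by (field; lra). exact L4. }
  set (A := 1 + 2 * y2 * v0 / eta).
  assert (HA1 : 1 <= A). { unfold A. assert (0 <= 2 * y2 * v0 / eta); [|lra]. apply Rmult_le_pos; [nra|apply Rlt_le, Rinv_0_lt_compat, Heta]. }
  assert (HA2 : 2 * y2 * v0 <= eta * A ^ 2).
  { assert (E : eta * A = eta + 2 * y2 * v0) by (unfold A; field; lra).
    assert (Hk : 0 <= 2 * y2 * v0) by (repeat apply Rmult_le_pos; lra).
    replace (eta * A ^ 2) with (A * (eta * A)) by ring. rewrite E. nra. }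
  destruct (Hproper (Rabs (Re w0) + A) y1 y2 Hy1) as [rho [Hrho H]].
  exists rho. split; [exact Hrho|]. intros z Hz Hzr.
  assert (Hv := Hpos z Hz). assert (Hs := Cmod_conj_minus (phi z) w0). assert (Hsq := Cmod2_alt (phi z - w0)).
  fold v0 in Hs. rewrite Im_minus, Re_minus in Hsq. fold v0 in Hsq.
  assert (Ha := Cmod_ge_0 (phi z - Cconj w0)). assert (Hb := Cmod_ge_0 (phi z - w0)).
  set (a := Cmod (phi z - Cconj w0)) in *. set (b := Cmod (phi z - w0)) in *.
  assert (Hout : ~ (Rabs (Re (phi z)) <= Rabs (Re w0) + A /\ y1 <= Im (phi z) <= y2)).
  { intros [H1 H2]. specialize (H z Hz H1 H2). lra. }
  set (v := Im (phi z)) in *. set (x := Re (phi z)) in *. set (x0 := Re w0) in *.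
  assert (Hx2 : 0 <= (x - x0) ^ 2) by apply pow2_ge_0. assert (Hv2 : 0 <= (v - v0) ^ 2) by apply pow2_ge_0.
  assert (Hkey : 4 * v * v0 <= 2 * eta * b ^ 2).
  { rewrite Hsq. destruct (Rlt_dec v y1) as [V1|V1].
    - assert (v0 * v0 / 4 <= (v - v0) ^ 2) by nra.
      assert (v * v0 <= eta * v0 / 8 * v0) by (apply Rmult_le_compat_r; lra).
      assert (eta * (v0 * v0 / 4) <= eta * (v - v0) ^ 2) by (apply Rmult_le_compat_l; lra).
      assert (0 <= eta * (x - x0) ^ 2) by (apply Rmult_le_pos; lra). lra.
    - destruct (Rlt_dec y2 v) as [V2|V2].
      + assert (v * v / 4 <= (v - v0) ^ 2) by nra.
        assert (8 * v0 <= eta * v).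
        { eapply Rle_trans; [exact L5|]. apply Rmult_le_compat_l; lra. }
        assert (8 * v0 * v <= eta * v * v) by (apply Rmult_le_compat_r; lra).
        assert (eta * (v * v / 4) <= eta * (v - v0) ^ 2) by (apply Rmult_le_compat_l; lra).
        assert (0 <= eta * (x - x0) ^ 2) by (apply Rmult_le_pos; lra). lra.
      + assert (HX : Rabs x0 + A < Rabs x) by (apply Rnot_le_lt; intros H1; apply Hout; lra).
        assert (HXA : A <= Rabs (x - x0)) by (generalize (Rabs_triang_inv x x0); lra).
        assert (A ^ 2 <= (x - x0) ^ 2) by (rewrite <- (pow2_abs (x - x0)); nra).
        assert (eta * A ^ 2 <= eta * (x - x0) ^ 2) by (apply Rmult_le_compat_l; lra).
        assert (v * v0 <= y2 * v0) by (apply Rmult_le_compat_r; lra).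
        assert (0 <= eta * (v - v0) ^ 2) by (apply Rmult_le_pos; lra). lra. }
  apply Rnot_lt_le. intros Hlt.
  assert (Hc : 0 <= (1 + eta) * b) by (apply Rmult_le_pos; lra).
  assert (H2 : ((1 + eta) * b) ^ 2 < a ^ 2) by (set (c := (1 + eta) * b) in *; nra).
  assert (0 <= (eta * b) ^ 2) by apply pow2_ge_0. nra.
Qed.

(** The quotient of the disk expression at [z] by the half-plane expression at [phi z] is
    differentiable off [z0] by injectivity, bounded near [z0] because [d] is not 0, and at most
    [1 + eta] near the circle by properness. The punctured maximum principle bounds it by 1. *)
Lemma inverse_Schwarz_Pick (z0 z d : C) :
  unit_disk z0 -> Cderiv phi z0 d -> d <> 0 -> unit_disk z -> z <> z0 ->
  Cmod (phi z - Cconj (phi z0)) * Cmod (z - z0) <=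
  Cmod (phi z - phi z0) * Cmod (1 - Cconj z0 * z).
Proof.
  intros Hz0 Hd Hdn Hz Hne. set (w0 := phi z0) in *. assert (Hv0 := Hpos z0 Hz0). fold w0 in Hv0.
  assert (Hm0 : Cmod z0 < 1) by exact Hz0.
  assert (Hden1 : forall u, unit_disk u -> u <> z0 -> 0 < Cmod (phi u - w0)).
  { intros u Hu Hn. apply Cmod_gt_0. intros E. apply Hn. apply Hinj; try assumption.
    replace (phi u) with (phi u - w0 + w0)%C by ring. rewrite E. unfold w0. ring. }
  assert (Hden2 : forall u, unit_disk u -> 0 < Cmod (1 - Cconj z0 * u)).
  { intros u Hu. generalize (disk_automorphism_den u z0 Hu Hz0). lra. }
  assert (Hmod : forall u, unit_disk u -> u <> z0 ->
    Cmod ((phi u - Cconj w0) * (u - z0) / ((phi u - w0) * (1 - Cconj z0 * u))) =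
    Cmod (phi u - Cconj w0) * Cmod (u - z0) / (Cmod (phi u - w0) * Cmod (1 - Cconj z0 * u))).
  { intros u Hu Hn. rewrite Cmod_div, !Cmod_mult; [reflexivity|].
    apply Cmult_neq_0; apply Cmod_gt_0; [now apply Hden1|now apply Hden2]. }
  assert (Hdm : 0 < Cmod d) by now apply Cmod_gt_0.
  destruct (Hd (Cmod d / 2)) as [r1 [Hr1 H1]]; [lra|].
  destruct (Cderiv_cont _ _ _ Hd 1 Rlt_0_1) as [r2 [Hr2 H2]]. fold w0 in H1, H2.
  assert (Hq : Cmod ((phi z - Cconj w0) * (z - z0) / ((phi z - w0) * (1 - Cconj z0 * z))) <= 1).
  { apply (punctured_maximum_modulus
      (fun z => (phi z - Cconj w0) * (z - z0) / ((phi z - w0) * (1 - Cconj z0 * z)))%C z0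
      (* Near [z0] one has [|phi u - conj w0| <= 1 + 2 * Im w0],
         [|phi u - w0| >= |d| / 2 * |u - z0|] and [|1 - conj z0 * u| >= 1 - |z0|]. *)
      ((1 + 2 * Im w0) / (Cmod d / 2 * (1 - Cmod z0))) (Rmin r1 r2) Hz0); try assumption.
    - now apply Rmin_glb_lt.
    - intros u Hu Hn. destruct (Hphi u Hu) as [du Hdu]. eapply Cderiv_div.
      + apply Cderiv_mult; apply Cderiv_minus; try apply Cderiv_const; [exact Hdu|apply Cderiv_id].
      + apply Cderiv_mult; apply Cderiv_minus; try apply Cderiv_const; [exact Hdu|].
        apply Cderiv_scal, Cderiv_id.
      + apply Cmult_neq_0; apply Cmod_gt_0; [now apply Hden1|now apply Hden2].
    - intros u Hu Hn Hur. rewrite Hmod by assumption.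
      assert (U1 : Cmod (u - z0) < r1) by (eapply Rlt_le_trans; [exact Hur|apply Rmin_l]).
      assert (U2 : Cmod (u - z0) < r2) by (eapply Rlt_le_trans; [exact Hur|apply Rmin_r]).
      specialize (H1 u U1). specialize (H2 u U2).
      assert (Hlow : Cmod d / 2 * Cmod (u - z0) <= Cmod (phi u - w0)).
      { generalize (Cmod_triangle_rev (d * (u - z0)) (phi u - w0)). rewrite Cmod_mult.
        rewrite (Cmod_minus_sym (d * (u - z0))). lra. }
      assert (Hup : Cmod (phi u - Cconj w0) <= 1 + 2 * Im w0).
      { replace (phi u - Cconj w0)%C with ((phi u - w0) + (w0 - Cconj w0))%C by ring.
        eapply Rle_trans; [apply Cmod_triangle|]. apply Rplus_le_compat; [lra|].
        eapply Rle_trans; [apply Cmod_le_abs|].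
        replace (Re (w0 - Cconj w0)) with 0 by (destruct w0; unfold Re, Cconj; simpl; ring).
        replace (Im (w0 - Cconj w0)) with (2 * Im w0) by (destruct w0; unfold Im, Cconj; simpl; ring).
        rewrite Rabs_R0, Rabs_pos_eq; lra. }
      assert (Hdn2 := disk_automorphism_den u z0 Hu Hz0).
      assert (P1 := Hden1 u Hu Hn). assert (P2 := Hden2 u Hu).
      assert (P3 := Cmod_ge_0 (u - z0)). assert (P4 := Cmod_ge_0 (phi u - Cconj w0)).
      apply Rle_div_l; [now apply Rmult_lt_0_compat|].
      set (K := 1 + 2 * Im w0) in *. set (k := Cmod d / 2) in *. assert (Hk : 0 < k) by (unfold k; lra).
      set (t := Cmod (u - z0)) in *. set (b := Cmod (phi u - w0)) in *.
      set (e := Cmod (1 - Cconj z0 * u)) in *. set (g := 1 - Cmod z0) in *. assert (Hg : 0 < g) by (unfold g; lra).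
      apply Rle_trans with (K * t); [apply Rmult_le_compat_r; assumption|].
      replace (K / (k * g) * (b * e)) with (K * ((b / k) * (e / g))) by (field; lra).
      apply Rmult_le_compat_l; [unfold K; lra|].
      assert (t <= b / k) by (apply Rle_div_r; [exact Hk|lra]).
      assert (1 <= e / g) by (apply Rle_div_r; lra). nra.
    - intros eta Heta. destruct (pseudo_hyperbolic_boundary w0 eta Hv0 Heta) as [rho [Hrho H]].
      exists rho. split; [exact Hrho|]. intros u Hu Hn Hur. rewrite Hmod by assumption.
      specialize (H u Hu Hur).
      assert (P1 := Hden1 u Hu Hn). assert (P2 := Hden2 u Hu).
      assert (P3 := Cmod_ge_0 (u - z0)). assert (P4 := Cmod_ge_0 (phi u - Cconj w0)).
      assert (Hle : Cmod (u - z0) <= Cmod (1 - Cconj z0 * u)).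
      { assert (Ha := disk_automorphism_mod u z0). unfold unit_disk in Hu.
        assert (0 <= (1 - Cmod u ^ 2) * (1 - Cmod z0 ^ 2)).
        { generalize (Cmod_ge_0 u) (Cmod_ge_0 z0). intros. apply Rmult_le_pos; nra. }
        apply Rnot_lt_le. intros Hlt. nra. }
      apply Rle_div_l; [now apply Rmult_lt_0_compat|].
      rewrite <- Rmult_assoc. apply Rmult_le_compat; assumption. }
  rewrite Hmod in Hq by assumption.
  apply Rle_div_l in Hq; [lra|]. apply Rmult_lt_0_compat; [now apply Hden1|now apply Hden2].
Qed.

(** Limit of the two-point inequality as [z = z0 + t] tends to [z0]: after division by [t], the
    distance to [conj (phi z0)] tends to [2 * Im (phi z0)]. The limit is replaced by a contradiction
    at one small [t]. *)
Lemma inverse_Schwarz_Pick_deriv (z0 d : C) :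
  unit_disk z0 -> Cderiv phi z0 d -> d <> 0 ->
  2 * Im (phi z0) <= Cmod d * (1 - Cmod z0 ^ 2).
Proof.
  intros Hz0 Hd Hdn. assert (Hm0 : Cmod z0 < 1) by exact Hz0. assert (Hp0 := Cmod_ge_0 z0).
  assert (Hv0 := Hpos z0 Hz0). assert (Hdm := Cmod_ge_0 d).
  apply Rnot_lt_le. intros Hlt. set (r := Cmod z0) in *. set (v0 := Im (phi z0)) in *.
  set (gap := 2 * v0 - Cmod d * (1 - r ^ 2)). assert (Hgap : 0 < gap) by (unfold gap; lra).
  (* Since [e <= 1], expanding [(|d| + e) * (1 - r^2 + 2 * e)] exceeds [|d| * (1 - r^2)] by at most
     [e * (3 + 2 * |d|)], which is less than [gap]. *)
  set (e := Rmin 1 (gap / (4 + 2 * Cmod d))).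
  assert (He : 0 < e) by (apply Rmin_glb_lt; [lra|]; apply Rdiv_lt_0_compat; lra).
  assert (He1 : e <= 1) by apply Rmin_l.
  assert (He2 : e * (4 + 2 * Cmod d) <= gap).
  { assert (Hr := Rmin_r 1 (gap / (4 + 2 * Cmod d))). fold e in Hr.
    apply (Rmult_le_compat_r (4 + 2 * Cmod d)) in Hr; [|lra].
    replace (gap / (4 + 2 * Cmod d) * (4 + 2 * Cmod d)) with gap in Hr by (field; lra). exact Hr. }
  clearbody e. destruct (Hd e He) as [del [Hdel H]].
  set (t := Rmin (del / 2) (Rmin e ((1 - r) / 2))).
  assert (Ht : 0 < t) by (unfold t; repeat apply Rmin_glb_lt; lra).
  assert (Lt : t <= del / 2 /\ t <= e /\ t <= (1 - r) / 2).
  { unfold t. generalize (Rmin_l (del / 2) (Rmin e ((1 - r) / 2))) (Rmin_r (del / 2) (Rmin e ((1 - r) / 2)))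
      (Rmin_l e ((1 - r) / 2)) (Rmin_r e ((1 - r) / 2)). lra. }
  set (z := (z0 + RtoC t)%C).
  assert (Ez : (z - z0)%C = RtoC t) by (unfold z; ring).
  assert (Hmz : Cmod (z - z0) = t) by (rewrite Ez, Cmod_R; apply Rabs_pos_eq; lra).
  assert (Hz : unit_disk z).
  { unfold unit_disk. generalize (Cmod_triangle_rev z z0). rewrite Hmz. fold r. lra. }
  assert (Hne : z <> z0) 
    by (intros E; rewrite E in Hmz; replace (z0 - z0)%C with (RtoC 0) in Hmz by ring; rewrite Cmod_0 in Hmz; lra).
  assert (SP := inverse_Schwarz_Pick z0 z d Hz0 Hd Hdn Hz Hne).
  specialize (H z ltac:(rewrite Hmz; lra)). rewrite Hmz in SP, H.
  assert (H1 : Cmod (phi z - phi z0) <= (Cmod d + e) * t).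
  { replace (phi z - phi z0)%C with ((phi z - phi z0 - d * (z - z0)) + d * (z - z0))%C by ring.
    eapply Rle_trans; [apply Cmod_triangle|]. rewrite Cmod_mult, Hmz. lra. }
  assert (H2 : 2 * v0 <= Cmod (phi z - Cconj (phi z0)) + Cmod (phi z - phi z0)).
  { rewrite (Cmod_minus_sym (phi z) (phi z0)). eapply Rle_trans; [|apply Cmod_triangle].
    eapply Rle_trans; [|apply im_le_Cmod]. eapply Rle_trans; [|apply Rle_abs].
    unfold v0. destruct (phi z), (phi z0). unfold Im, Cconj; simpl. lra. }
  assert (H3 : Cmod (1 - Cconj z0 * z) <= (1 - r ^ 2) + t).
  { replace (1 - Cconj z0 * z)%C with (RtoC (1 - r ^ 2) - Cconj z0 * RtoC t)%C.
    - eapply Rle_trans; [apply Cmod_triangle|]. rewrite Cmod_opp, Cmod_mult, Cmod_conj, !Cmod_R. fold r.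
      rewrite (Rabs_pos_eq t), Rabs_pos_eq by nra. nra.
    - rewrite <- Ez. unfold r. rewrite RtoC_minus, Cmod2_conj. ring. }
  assert (H4 : Cmod (phi z - Cconj (phi z0)) <= (Cmod d + e) * (1 - r ^ 2 + t)).
  { apply Rmult_le_reg_r with t; [exact Ht|]. eapply Rle_trans; [exact SP|].
    apply Rle_trans with ((Cmod d + e) * t * (1 - r ^ 2 + t)); [|apply Req_le; ring].
    apply Rmult_le_compat; try apply Cmod_ge_0; assumption. }
  assert (H5 : 2 * v0 <= (Cmod d + e) * (1 - r ^ 2 + 2 * t)) by lra.
  assert (H6 : (Cmod d + e) * (1 - r ^ 2 + 2 * t) <= (Cmod d + e) * (1 - r ^ 2 + 2 * e))
    by (apply Rmult_le_compat_l; lra).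
  unfold gap in *. assert (0 <= r ^ 2) by apply pow2_ge_0. nra.
Qed.

Lemma deriv_lower_bound (z d : C) :
  unit_disk z -> Cderiv phi z d -> d <> 0 -> Im (phi 0) / 2 <= Cmod d.
Proof.
  intros Hz Hd Hdn. assert (H1 := inverse_Schwarz_Pick_deriv z d Hz Hd Hdn).
  assert (H2 := Harnack z Hz). unfold unit_disk in Hz. assert (Hp := Cmod_ge_0 z).
  assert (H0 : 0 < Im (phi 0)) by (apply Hpos; unfold unit_disk; rewrite Cmod_0; lra).
  set (r := Cmod z) in *. set (m := Cmod d) in *. assert (Hm : 0 <= m) by apply Cmod_ge_0.
  assert (H3 : 2 * (Im (phi 0) * (1 - r)) <= m * (1 + r) ^ 2 * (1 - r)) by nra.
  assert (H4 : 2 * Im (phi 0) <= m * (1 + r) ^ 2) by (apply Rmult_le_reg_r with (1 - r); lra).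
  assert (H5 : (1 + r) ^ 2 <= 4) by nra. nra.
Qed.

End SchwarzPick.

(** * Sharpness *)

Lemma Cderiv_real_differentiable (f : C -> C) (z d : C) :
  Cderiv f z d -> real_differentiable_at f z.
Proof.
  intros H.
  exists (fun y => (d * y)%C). split.
  - constructor.
    + intros x y. apply Cmult_plus_distr_l.
    + intros k [x y]. destruct d as [d1 d2]. unfold scal; simpl. unfold prod_scal, Cmult; simpl.
      unfold scal; simpl. unfold mult; simpl. f_equal; ring.
    + exists (Cmod d + 1). split; [generalize (Cmod_ge_0 d); lra|]. intros x.
      rewrite !norm_C_R, Cmod_mult. generalize (Cmod_ge_0 x). lra.
  - intros x Hx.
    assert (Hxz : z = x) by (apply (@is_filter_lim_locally_unique R_AbsRing C_R_NormedModule); exact Hx).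
    subst x. intros eps. destruct (H eps (cond_pos eps)) as [del [Hdel HH]].
    (* Balls of [C_R_NormedModule] are squares, hence the halved radius. *)
    assert (Hd2 : 0 < del / 2) by lra.
    exists (mkposreal _ Hd2). intros w [B1 B2].
    change (Rabs (Re w - Re z) < del / 2) in B1. change (Rabs (Im w - Im z) < del / 2) in B2.
    assert (Hw : Cmod (w - z) < del).
    { eapply Rle_lt_trans; [apply Cmod_le_abs|]. rewrite Re_minus, Im_minus. lra. }
    rewrite !norm_C_R. exact (HH w Hw).
Qed.

(** The map [i (1 + z) / (1 - z)], written with a single reciprocal so that [Cderiv_inv] gives its
    derivative [2 i / (1 - z)^2]. *)
Definition cayley (z : C) : C := (Ci * (2 * / (1 - z) - 1))%C.

Lemma disk_neq_1 (z : C) : unit_disk z -> (1 - z)%C <> 0.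
Proof.
  unfold unit_disk. intros Hz E. replace z with (1 - (1 - z))%C in Hz by ring.
  rewrite E in Hz. replace (1 - 0)%C with (RtoC 1) in Hz by ring. rewrite Cmod_1 in Hz. lra.
Qed.

Lemma half_plane_neq_opp_i (w : C) : upper_half_plane w -> (w + Ci)%C <> 0.
Proof.
  unfold upper_half_plane. intros Hw E. apply (f_equal Im) in E. destruct w. unfold Im in *; simpl in *. lra.
Qed.

Lemma Cderiv_cayley (z : C) : unit_disk z ->
  Cderiv cayley z (Ci * (2 * / ((1 - z) * (1 - z)))).
Proof.
  intros Hz. assert (Hn := disk_neq_1 z Hz).
  replace (Ci * (2 * / ((1 - z) * (1 - z))))%C
    with (Ci * (2 * ((0 - 1) * (- / ((1 - z) * (1 - z)))) - 0))%C by (field; exact Hn).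
  apply (Cderiv_scal Ci (fun z => 2 * / (1 - z) - 1)%C).
  apply Cderiv_minus; [|apply Cderiv_const].
  apply (Cderiv_scal 2 (fun z => / (1 - z))%C).
  apply (Cderiv_comp (fun w => / w)%C (fun z => 1 - z)%C); [now apply Cderiv_inv|].
  apply Cderiv_minus; [apply Cderiv_const|apply Cderiv_id].
Qed.

(** The imaginary part is the Poisson kernel [(1 - |z|^2) / |1 - z|^2]. *)
Lemma cayley_half_plane (z : C) : unit_disk z -> upper_half_plane (cayley z).
Proof.
  intros Hz. assert (Hn := disk_neq_1 z Hz). apply Cmod_gt_0 in Hn.
  unfold unit_disk in Hz. assert (Hz0 := Cmod_ge_0 z).
  assert (Hz2 : Re z ^ 2 + Im z ^ 2 < 1) by (rewrite <- Cmod2_alt; nra).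
  assert (Hn2 : 0 < Cmod (1 - z) ^ 2) by now apply pow_lt.
  rewrite Cmod2_alt in Hn2. unfold upper_half_plane.
  destruct z as [x y]. unfold Re, Im in *; simpl in *.
  match goal with |- 0 < ?e =>
    replace e with ((1 - (x * (x * 1) + y * (y * 1))) / ((1 + - x) * ((1 + - x) * 1) + (0 + - y) * ((0 + - y) * 1)))
  end.
  - apply Rdiv_lt_0_compat; lra.
  - field. nra.
Qed.

Lemma cayley_admissible : admissible cayley cayley (fun _ => 0).
Proof.
  assert (Hc : forall c z, Cderiv (fun _ => c) z 0) by apply Cderiv_const.
  split; [|split; [|split; [|split; [split; [|split]|]]]].
  - intros z Hz. eexists. apply Cderiv_is_derive_C, Cderiv_cayley, Hz.
  - intros z Hz. exists (RtoC 0). apply Cderiv_is_derive_C, Hc.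
  - intros z Hz. unfold Cconj; simpl. rewrite Ropp_0. change (cayley z = cayley z + 0)%C. ring.
  - exact cayley_half_plane.
  - intros z Hz. eapply Cderiv_real_differentiable, Cderiv_cayley, Hz.
  - exists (fun w => (w - Ci) / (w + Ci))%C. split; [|split].
    + intros w Hw. assert (Hn := half_plane_neq_opp_i w Hw). split.
      * unfold unit_disk. rewrite Cmod_div by exact Hn. assert (Hp : 0 < Cmod (w + Ci)) by now apply Cmod_gt_0.
        apply Rlt_div_l; [exact Hp|]. rewrite Rmult_1_l.
        assert (H1 := Cmod_conj_minus w Ci). assert (Hm := Cmod_ge_0 (w - Ci)).
        replace (w - Cconj Ci)%C with (w + Ci)%C in H1
          by (destruct w; unfold Cconj, Ci, Cminus, Cplus, Copp; simpl; f_equal; ring).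
        unfold upper_half_plane in Hw. change (Im Ci) with 1 in H1. nra.
      * unfold cayley. assert (Hi : Ci <> 0) by (intros E; apply (f_equal Im) in E; unfold Im in E; simpl in E; lra).
        assert (H2 : (RtoC 2) <> 0) by (intros E; apply (f_equal Re) in E; unfold Re in E; simpl in E; lra).
        replace (1 - (w - Ci) / (w + Ci))%C with (2 * Ci / (w + Ci))%C by (field; exact Hn).
        field. repeat split; assumption.
    + intros z Hz. assert (Hn := disk_neq_1 z Hz). unfold cayley.
      assert (Hi : Ci <> 0) by (intros E; apply (f_equal Im) in E; unfold Im in E; simpl in E; lra).
      assert (H2 : (RtoC 2) <> 0) by (intros E; apply (f_equal Re) in E; unfold Re in E; simpl in E; lra).
      replace (Ci * (2 * / (1 - z) - 1) + Ci)%C with (2 * Ci / (1 - z))%C by (field; exact Hn).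
      field. repeat split; assumption.
    + intros w Hw. assert (Hn := half_plane_neq_opp_i w Hw).
      destruct (Cderiv_div (fun w => w - Ci)%C (fun w => w + Ci)%C w (1 - 0) (1 + 0)) as [d Hd].
      * apply Cderiv_minus; [apply Cderiv_id|apply Hc].
      * apply Cderiv_plus; [apply Cderiv_id|apply Hc].
      * exact Hn.
      * exact (Cderiv_real_differentiable _ _ _ Hd).
  - unfold cayley. field.
Qed.

Lemma cayley_deriv_small (c : R) : / 2 < c ->
  (* At [z = 1 - s] the derivative has modulus [2 / s^2]. It is below [c] when [s^2 > 2 / c], and
     [z] is in the disk when [0 < s] and [s^2 < 4]; the value [2 + / c] is the midpoint of the two
     bounds. *)
  exists z, unit_disk z /\ Cmod (C_derive cayley z) < c.
Proof.
  intros Hc. set (s := sqrt (2 + / c)).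
  assert (Hc2 : 0 < / c < 2).
  { split; [apply Rinv_0_lt_compat; lra|]. rewrite <- (Rinv_inv 2). apply Rinv_lt_contravar; lra. }
  assert (Hs : 0 < s) by (apply sqrt_lt_R0; lra).
  assert (Hs2 : s * s = 2 + / c) by (apply sqrt_sqrt; lra).
  assert (Hs4 : s < 2) by nra.
  assert (Hz : unit_disk (RtoC (1 - s))).
  { unfold unit_disk. rewrite Cmod_R. apply Rabs_def1; lra. }
  exists (RtoC (1 - s)). split; [exact Hz|].
  rewrite (is_C_derive_unique cayley _ _ (proj1 (Cderiv_is_derive_C _ _ _) (Cderiv_cayley _ Hz))).
  replace (1 - RtoC (1 - s))%C with (RtoC s) by (rewrite RtoC_minus; ring).
  assert (Hsn : RtoC s <> 0) by (intros E; apply (f_equal Re) in E; unfold Re in E; simpl in E; lra).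
  rewrite !Cmod_mult, Cmod_inv, Cmod_mult, !Cmod_R, Cmod_Ci by (apply Cmult_neq_0; exact Hsn).
  rewrite (Rabs_pos_eq 2), (Rabs_pos_eq s) by lra. rewrite Hs2.
  rewrite Rmult_1_l. apply Rlt_div_l; [lra|].
  replace (c * (2 + / c)) with (2 * c + 1) by (field; lra). lra.
Qed.

Theorem theorem1p2 :
  (forall f h g : C -> C, admissible f h g ->
     forall z, unit_disk z ->
       Cmod (C_derive h z) + Cmod (C_derive g z)
         >= / 2 * dist_to_boundary_U (f (RtoC 0))) /\
  (forall c : R, c > / 2 * dist_to_boundary_U Ci ->
     exists f h g : C -> C, admissible f h g /\
       exists z, unit_disk z /\
         Cmod (C_derive h z) + Cmod (C_derive g z) < c).
Proof.
  split.
  - intros f h g [Hh [Hg [Hf [[HfU [_ [F [HF1 [HF2 HF3]]]]] Hf0]]]] z Hz.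
    assert (Hdh : forall u, unit_disk u -> Cderiv h u (C_derive h u)).
    { intros u Hu. apply Cderiv_is_derive_C, C_derive_correct; [exact u|now apply Hh]. }
    assert (Hdg : forall u, unit_disk u -> Cderiv g u (C_derive g u)).
    { intros u Hu. apply Cderiv_is_derive_C, C_derive_correct; [exact u|now apply Hg]. }
    set (phi := fun u => (h u - g u)%C). set (P := fun u => (h u + g u)%C).
    assert (Hphi : forall u, unit_disk u -> Cderiv phi u (C_derive h u - C_derive g u)).
    { intros u Hu. apply Cderiv_minus; [now apply Hdh|now apply Hdg]. }
    assert (Hphi' : forall u, unit_disk u -> exists d, Cderiv phi u d) by (intros u Hu; eexists; now apply Hphi).
    assert (HP : forall u, unit_disk u -> exists d, Cderiv P u d).
    { intros u Hu. eexists. apply Cderiv_plus; [now apply Hdh|now apply Hdg]. }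
    assert (Hfc : forall u, unit_disk u -> Re (f u) = Re (P u) /\ Im (f u) = Im (phi u)).
    { intros u Hu. rewrite (Hf u Hu). unfold P, phi. destruct (h u), (g u). split; reflexivity. }
    assert (HFD : forall w, upper_half_plane w ->
      unit_disk (F w) /\ Re (P (F w)) = Re w /\ Im (phi (F w)) = Im w).
    { intros w Hw. destruct (HF1 w Hw) as [HD HE]. destruct (Hfc (F w) HD) as [E1 E2].
      rewrite HE in E1, E2. auto. }
    assert (Hinv : forall u, unit_disk u -> 0 < Im (phi u) /\ F (Re (P u), Im (phi u)) = u).
    { intros u Hu. destruct (Hfc u Hu) as [E1 E2]. rewrite <- E1, <- E2. split; [now apply HfU|].
      rewrite <- (HF2 u Hu) at 3. f_equal. now destruct (f u). }
    destruct (shear_sheared phi P F Hphi' HP HFD HF3 Hinv) as [P' [F' Hsh]].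
    (* Every [z] in the disk is [F (f z)], so the nonvanishing at points [F w] covers it. *)
    assert (Hd0 : (C_derive h z - C_derive g z)%C <> 0).
    { apply (shear_phi_deriv_neq_0 phi P F HFD HF3 (f z)); [now apply HfU|].
      rewrite (HF2 z Hz). now apply Hphi. }
    assert (Hlow : Im (phi 0) / 2 <= Cmod (C_derive h z - C_derive g z)).
    { apply (deriv_lower_bound phi Hphi') with (z := z); try assumption.
      - intros u Hu. now apply Hinv.
      - intros u u'. exact (sheared_inj _ _ _ _ Hsh u u').
      - intros A y1 y2 Hy1. apply (sheared_proper phi P' (fun y => 0 < y) F'); [exact Hsh|].
        intros y Hy. lra.
      - now apply Hphi. }
    assert (H0 : unit_disk 0) by (unfold unit_disk; rewrite Cmod_0; lra).
    destruct (Hfc 0 H0) as [_ E0]. destruct (Hinv 0 H0) as [Hpos _]. rewrite <- E0 in Hlow, Hpos.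
    unfold dist_to_boundary_U. rewrite Rabs_pos_eq by lra.
    generalize (Cmod_triangle (C_derive h z) (- C_derive g z)). rewrite Cmod_opp.
    change (C_derive h z + - C_derive g z)%C with (C_derive h z - C_derive g z)%C. lra.
  - intros c Hc. unfold dist_to_boundary_U in Hc. change (Im Ci) with 1 in Hc. rewrite Rabs_R1 in Hc.
    destruct (cayley_deriv_small c) as [z [Hz Hlt]]; [lra|].
    exists cayley, cayley, (fun _ => 0). split; [exact cayley_admissible|].
    exists z. split; [exact Hz|].
    rewrite (is_C_derive_unique (fun _ => 0) z 0); [|apply Cderiv_is_derive_C, Cderiv_const].
    rewrite Cmod_0. lra.
Qed.
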